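(* Let $G$ be a finite group. The parks homomorphism $\chi\colon\mathring{A}(G)\to\mathrm{Parks}(G)$ is rationally an isomorphism. That is, \[\mathbb{Q}\otimes\chi\colon\mathbb{Q}\otimes\mathring{A}(G)\to\mathbb{Q}\otimes\mathrm{Parks}(G)\cong\mathrm{Parks}(G,\mathbb{Q})\] is an isomorphism. In particular, the maps $\mathbb{Q}\otimes\mathring{A}(G,n)\to\mathrm{Parks}(G,n,\mathbb{Q})$ are isomorphisms for all $n\ge0$.
   Context: For a finite group $\Gamma$, $A(\Gamma)$ is the Burnside ring, with canonical $\mathbb{Z}$-basis the isomorphism classes of transitive $\Gamma$-sets; $\mathrm{Conj}(\Gamma)$ is the set of conjugacy classes of subgroups; the marks homomorphism $\chi\colon A(\Gamma)\to\mathrm{Marks}(\Gamma)=\mathrm{Fun}(\mathrm{Conj}(\Gamma),\mathbb{Z})$ is $\chi([X])([H])=|X^H|$. $G\wr\Sigma_n=G^{\times n}\rtimes\Sigma_n$ acts on $X^{\times n}$, for a left $G$-set $X$, by $((\bar g,\sigma)x)_i=\bar g_ix_{\sigma^{-1}(i)}$. The transfer product $\star\colon A(G\wr\Sigma_i)\otimes A(G\wr\Sigma_j)\to A(G\wr\Sigma_{i+j})$ is $X\star Y=(G\wr\Sigma_{i+j})\times_{G\wr\Sigma_i\times G\wr\Sigma_j}(X\times Y)$. The total power operations $\mathbb{P}_n\colon A(G)\to A(G\wr\Sigma_n)$ are the unique functions with $\mathbb{P}_n([X])=[X^{\times n}]$, $\mathbb{P}_0=1$ and $\mathbb{P}_n(x+y)=\sum_{i+j=n}\mathbb{P}_i(x)\star\mathbb{P}_j(y)$.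 $\mathring{A}(G,n)\subseteq A(G\wr\Sigma_n)$ is the summand spanned by the smallest subset of the canonical basis whose span contains the image of $\mathbb{P}_n$. $\mathring{A}(G)=\bigoplus_{n\ge0}\mathring{A}(G,n)$ is a commutative graded ring under $\star$, in fact a polynomial ring on the generators $\mathbb{P}_n([G/H])$ in degree $n$, for $n>0$ and $[H]\in\mathrm{Conj}(G)$. $\mathrm{Parts}(G)$ is the free commutative monoid on $\mathrm{Conj}(G)\times\mathbb{N}_{>0}$, whose elements are finitely supported functions $\lambda\colon\mathrm{Conj}(G)\times\mathbb{N}_{>0}\to\mathbb{N}$; $\|\lambda\|=\sum\lambda_{[H],m}m$, $\lambda!=\prod\lambda_{[H],m}!$, and $\mathrm{Parts}(G,n)=\{\lambda:\|\lambda\|=n\}$. For a commutative ring $R$ (omitted when $R=\mathbb{Z}$), $\mathrm{Parks}(G,n,R)=\mathrm{Fun}(\mathrm{Parts}(G,n),R)$, and $\mathrm{Parks}(G,R)=\bigoplus_n\mathrm{Parks}(G,n,R)$ is the group of finitely supported functions $\mathrm{Parts}(G)\to R$, a commutative graded ring under $(f\star g)(\mu)=\sum_{\kappa+\lambda=\mu}\frac{\mu!}{\kappa!\lambda!}f(\kappa)g(\lambda)$. The parks homomorphism $\chi\colon\mathring{A}(G)\to\mathrm{Parks}(G)$ is the unique homomorphism of graded rings (for the $\star$-products) such that $\chi(\mathbb{P}_n(x))(\lambda)=\prod_{[H],m}\chi(x)([H])^{\lambda_{[H],m}}$ for all $x\in A(G)$, $n\ge0$, $\lambda\in\mathrm{Parts}(G,n)$;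 here $\chi(x)$ is the mark of $x$. *)

(* Defs.v *)
From HB Require Import structures.
From mathcomp Require Import all_boot all_order all_algebra all_fingroup.
From mathcomp Require Import finmap.
From mathcomp Require Import boolp classical_sets functions cardinality fsbigop.
From mathcomp Require Import generic_quotient freeg.

Set Implicit Arguments.
Unset Strict Implicit.
Unset Printing Implicit Defensive.

Import GRing.Theory.
Local Open Scope ring_scope.
Local Open Scope quotient_scope.

(* The tensor product of two abelian groups: the free abelian group on U * V  *)
(* modulo the subgroup generated by the biadditivity relations.               *)

Section Tensor.
Variables U V : zmodType.
Local Notation F := {freeg (U * V)%type / int}.

Definition pure (u : U) (v : V) : F := << (u, v) >>.

Definition contains_tensor_rel (S : {pred F}) : Prop :=
  (forall u u' v, pure (u + u') v - pure u v - pure u' v \in S) /\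
  (forall u v v', pure u (v + v') - pure u v - pure u v' \in S).

Definition tensor_rel : {pred F} := fun D =>
  `[< forall S : {pred F}, zmod_closed S -> contains_tensor_rel S -> D \in S >].

Lemma tensor_rel_closed : zmod_closed tensor_rel.
Proof.
split; first by apply/asboolP => S [].
move=> x y /asboolP xS /asboolP yS; apply/asboolP => S Sz Sr.
by case: (Sz) => _; apply; [apply: xS|apply: yS].
Qed.

Lemma tensor_rel_contains : contains_tensor_rel tensor_rel.
Proof. by split=> *; apply/asboolP => S _ []. Qed.

HB.instance Definition _ :=
  GRing.isZmodClosed.Build F tensor_rel tensor_rel_closed.

Definition tensor_equiv (D E : F) : bool := D - E \in tensor_rel.

Lemma tensor_equiv_equiv : equiv_class_of tensor_equiv.
Proof.
split=> [D|D E|E D C]; rewrite /tensor_equiv.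
- by rewrite subrr rpred0.
- by rewrite -opprB rpredN.
- by move=> h1 h2; rewrite -(subrK E D) -addrA rpredD.
Qed.

Canonical tensor_equiv_rel := EquivRelPack tensor_equiv_equiv.

Definition tensor := {eq_quot tensor_equiv}.
HB.instance Definition _ := EqQuotient.on tensor.
HB.instance Definition _ := Choice.on tensor.

Lemma tensor_piP D E : reflect (\pi_tensor D = \pi_tensor E) (D - E \in tensor_rel).
Proof. exact: (@eqquotP _ tensor_equiv tensor). Qed.

Definition tensor_zero : tensor := \pi_tensor 0.
Definition tensor_opp (x : tensor) : tensor := \pi_tensor (- repr x).
Definition tensor_add (x y : tensor) : tensor := \pi_tensor (repr x + repr y).

Lemma tensor_repr D : D - repr (\pi_tensor D) \in tensor_rel.
Proof. by apply/tensor_piP; rewrite reprK. Qed.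

Lemma tensor_pi_opp D : tensor_opp (\pi_tensor D) = \pi_tensor (- D).
Proof. by apply/tensor_piP; rewrite opprK addrC tensor_repr. Qed.

Lemma tensor_pi_add D E : tensor_add (\pi_tensor D) (\pi_tensor E) = \pi_tensor (D + E).
Proof.
apply/tensor_piP; rewrite -opprB rpredN opprD addrACA.
by rewrite rpredD // tensor_repr.
Qed.

Lemma tensor_addA : associative tensor_add.
Proof.
move=> x y z; rewrite -[x]reprK -[y]reprK -[z]reprK.
move: (repr x) (repr y) (repr z) => a b c.
by rewrite (tensor_pi_add b) (tensor_pi_add a) (tensor_pi_add a)
  (tensor_pi_add (a + b)) addrA.
Qed.
Lemma tensor_addC : commutative tensor_add.
Proof. by move=> x y; rewrite -[x]reprK -[y]reprK !tensor_pi_add addrC. Qed.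
Lemma tensor_add0 : left_id tensor_zero tensor_add.
Proof. by move=> x; rewrite -[x]reprK !tensor_pi_add add0r. Qed.
Lemma tensor_addN : left_inverse tensor_zero tensor_opp tensor_add.
Proof. by move=> x; rewrite -[x]reprK tensor_pi_opp tensor_pi_add addNr. Qed.

HB.instance Definition _ := GRing.isZmodule.Build tensor
  tensor_addA tensor_addC tensor_add0 tensor_addN.

Definition tens (u : U) (v : V) : tensor := \pi_tensor (pure u v).

Definition biadditive (W : zmodType) (b : U -> V -> W) : Prop :=
  (forall v, {morph b^~ v : u u' / u + u'}) /\
  (forall u, {morph b u : v v' / v + v'}).

Definition tensor_lift (W : zmodType) (b : U -> V -> W) (t : tensor) : W :=
  fglift (fun uv : U * V => b uv.1 uv.2 : zmodule W) (repr t).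

Section Lift.
Variables (W : zmodType) (b : U -> V -> W) (b_biadd : biadditive b).
Let l : F -> W := fglift (fun uv : U * V => b uv.1 uv.2 : zmodule W).

Let lB x y : l (x - y) = l x - l y.
Proof. exact: (@lift_is_additive int _ (zmodule W) (fun uv => b uv.1 uv.2) x y). Qed.

Let lpure u v : l (pure u v) = b u v.
Proof. by rewrite /l liftU (scale1r (_ : zmodule W)). Qed.

Lemma tensor_lift_pi D : tensor_lift b (\pi_tensor D) = l D.
Proof.
pose S : {pred F} := fun D => l D == 0.
have SE C : (C \in S) = (l C == 0) by [].
have l0 : l 0 = 0 by have := lB 0 0; rewrite !subrr.
have /asboolP/(_ S) : D - repr (\pi_tensor D) \in tensor_rel := tensor_repr D.
rewrite SE lB subr_eq0 => h; apply/esym/eqP/h.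
  by split=> [|x y]; rewrite !SE ?l0 // lB => /eqP-> /eqP->; rewrite subrr.
have [bl br] := b_biadd.
by split=> *; rewrite SE !lB !lpure ?bl ?br -addrA -opprD subrr.
Qed.

Lemma tensor_lift_tens u v : tensor_lift b (tens u v) = b u v.
Proof. by rewrite tensor_lift_pi lpure. Qed.

Lemma tensor_liftB : {morph tensor_lift b : x y / x - y}.
Proof.
move=> x y; rewrite -[x]reprK -[y]reprK; move: (repr x) (repr y) => {}x {}y.
have -> : \pi_tensor x - \pi_tensor y = \pi_tensor (x - y).
  by rewrite -tensor_pi_add -tensor_pi_opp.
by rewrite !tensor_lift_pi lB.
Qed.
End Lift.

End Tensor.

Lemma tens_biadditive (U V : zmodType) : biadditive (@tens U V).
Proof.
have [h1 h2] := tensor_rel_contains U V.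
by split=> [v u u'|u v v']; rewrite /tens;
  rewrite [RHS]tensor_pi_add; apply/tensor_piP; rewrite opprD addrA.
Qed.

Definition tensor_map (U V U' V' : zmodType) (f : U -> U') (g : V -> V') :
    tensor U V -> tensor U' V' :=
  tensor_lift (fun u v => tens (f u) (g v)).

Section TensorMap.
Variables (U V U' V' : zmodType) (f : {additive U -> U'}) (g : {additive V -> V'}).

Lemma tensor_map_biadditive : biadditive (fun u v => tens (f u) (g v)).
Proof.
have [bl br] := tens_biadditive U' V'.
by split=> [v u u'|u v v'] /=; rewrite raddfD ?bl ?br.
Qed.

Lemma tensor_map_tens u v : tensor_map f g (tens u v) = tens (f u) (g v).
Proof. exact: (tensor_lift_tens tensor_map_biadditive). Qed.

Lemma tensor_map_zmod_morphism : zmod_morphism (tensor_map f g).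
Proof. exact: (tensor_liftB tensor_map_biadditive). Qed.
HB.instance Definition _ := GRing.isZmodMorphism.Build (tensor U V) (tensor U' V')
  (tensor_map f g) tensor_map_zmod_morphism.
End TensorMap.

Section DirectSum.
Variable M : nat -> zmodType.

Definition finite_support (x : forall n, M n) : Prop :=
  exists N, forall n, (N <= n)%N -> x n = 0.

Record dsum := DSum {
  dsum_fun :> forall n, M n;
  dsum_finite : finite_support dsum_fun
}.

HB.instance Definition _ := gen_eqMixin dsum.
HB.instance Definition _ := gen_choiceMixin dsum.

Lemma dsum_eq (x y : dsum) : (forall n, x n = y n) -> x = y.
Proof.
case: x y => [x xP] [y yP] /= xy.
have {xy} e : x = y by apply: functional_extensionality_dep.
by subst y; congr DSum; apply: Prop_irrelevance.
Qed.

Lemma dsum_zero_subproof : finite_support (fun n => 0 : M n).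
Proof. by exists 0%N. Qed.
Lemma dsum_opp_subproof (x : dsum) : finite_support (fun n => - x n).
Proof. by have [N xN] := dsum_finite x; exists N => n /xN ->; rewrite oppr0. Qed.
Lemma dsum_add_subproof (x y : dsum) : finite_support (fun n => x n + y n).
Proof.
have [[N xN] [K yK]] := (dsum_finite x, dsum_finite y).
by exists (maxn N K) => n; rewrite geq_max => /andP[/xN -> /yK ->]; rewrite addr0.
Qed.

Definition dsum_zero := DSum dsum_zero_subproof.
Definition dsum_opp x := DSum (dsum_opp_subproof x).
Definition dsum_add x y := DSum (dsum_add_subproof x y).

Lemma dsum_addA : associative dsum_add.
Proof. by move=> x y z; apply: dsum_eq => n /=; rewrite addrA. Qed.
Lemma dsum_addC : commutative dsum_add.
Proof. by move=> x y; apply: dsum_eq => n /=; rewrite addrC. Qed.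
Lemma dsum_add0 : left_id dsum_zero dsum_add.
Proof. by move=> x; apply: dsum_eq => n /=; rewrite add0r. Qed.
Lemma dsum_addN : left_inverse dsum_zero dsum_opp dsum_add.
Proof. by move=> x; apply: dsum_eq => n /=; rewrite addNr. Qed.

HB.instance Definition _ := GRing.isZmodule.Build dsum
  dsum_addA dsum_addC dsum_add0 dsum_addN.

Definition dsum_in_fun n (a : M n) (m : nat) : M m :=
  if n =P m is ReflectT e then ecast k (M k) e a else 0.

Lemma dsum_in_subproof n (a : M n) : finite_support (dsum_in_fun a).
Proof.
exists n.+1 => m nm; rewrite /dsum_in_fun; case: eqP => // e.
by have := nm; rewrite -[X in (_ < X)%N]e ltnn.
Qed.

Definition dsum_in n (a : M n) : dsum := DSum (dsum_in_subproof a).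

Lemma dsum_in_id n (a : M n) : dsum_in a n = a.
Proof. by rewrite /= /dsum_in_fun; case: eqP => // e; rewrite eq_axiomK. Qed.

Lemma dsum_in_neq n (a : M n) m : n != m -> dsum_in a m = 0.
Proof. by rewrite /= /dsum_in_fun; case: eqP. Qed.

End DirectSum.

(* Finite left sets over a finite group. MathComp actions are right actions,  *)
(* so a left set is also seen as the right action x * g := g^-1 x, which has  *)
(* the same orbits, stabilisers and fixed points.                             *)

Local Open Scope group_scope.

Record gset (gT : finGroupType) := GSet {
  gset_car :> finType;
  gact : gT -> gset_car -> gset_car;
  gact1 : forall x, gact 1 x = x;
  gactM : forall g h x, gact (g * h) x = gact g (gact h x)
}.

Section GSetAction.
Variables (gT : finGroupType) (X : gset gT).

Lemma ract_subproof1 : (fun (x : X) (g : gT) => gact g^-1 x)^~ 1 =1 id.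
Proof. by move=> x; rewrite /= invg1 gact1. Qed.
Lemma ract_subproof2  : forall x, act_morph (fun (x : X) (g : gT) => gact g^-1 x) x.
Proof. by move=> x g h; rewrite invMg gactM. Qed.

Definition ract : {action gT &-> X} :=
  TotalAction ract_subproof1 ract_subproof2.

Definition gorbits : {set {set X}} := orbit ract [set: gT] @: [set: X].
Definition gstab (x : X) : {group gT} := 'C[x | ract]%G.
Definition gfix (H : {group gT}) : {set X} := 'Fix_ract(H).

End GSetAction.

Section Constructions.
Variable gT : finGroupType.

Definition gunit : gset gT := @GSet gT unit (fun _ x => x) (fun=> erefl) (fun _ _ _ => erefl).

Section Cosets.
Variable H : {group gT}.

Definition coset_car := {A : {set gT} | A \in lcosets H [set: gT]}.

Lemma coset_act_subproof g (A : coset_car) : g *: val A \in lcosets H [set: gT].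
Proof.
case: A => A /= /lcosetsP[x _ ->]; rewrite -lcosetM.
by apply/lcosetsP; exists (g * x); rewrite ?inE.
Qed.
Definition coset_act g (A : coset_car) : coset_car :=
  Sub (g *: val A) (coset_act_subproof g A).
Lemma coset_act1 A : coset_act 1 A = A.
Proof. by apply/val_inj; rewrite /= lcoset1. Qed.
Lemma coset_actM g h A : coset_act (g * h) A = coset_act g (coset_act h A).
Proof. by apply/val_inj; rewrite /= lcosetM. Qed.

Definition gcoset : gset gT := GSet coset_act1 coset_actM.
End Cosets.

Section Product.
Variables (hT : finGroupType) (X : gset gT) (Y : gset hT).
Definition prod_act (g : (gT * hT)%type) (p : (X * Y)%type) : (X * Y)%type :=
  (gact g.1 p.1, gact g.2 p.2).
Lemma prod_act1 p : prod_act 1 p = p.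
Proof. by case: p => x y; rewrite /prod_act !gact1. Qed.
Lemma prod_actM g h p : prod_act (g * h) p = prod_act g (prod_act h p).
Proof. by rewrite /prod_act /= !gactM. Qed.
Definition gprod : gset (gT * hT)%type := GSet prod_act1 prod_actM.
End Product.

(* the balanced product gT *_hT Z along phi: classes of pairs (g, z) under    *)
(* (g * phi h, z) ~ (g, h z)                                                  *)
Section Induction.
Variables (hT : finGroupType) (phi : {morphism [set: hT] >-> gT}) (Z : gset hT).

Definition ind_class (p : (gT * Z)%type) : {set (gT * Z)%type} :=
  [set (p.1 * (phi h)^-1, gact h p.2) | h : hT].

Definition ind_car := {A : {set (gT * Z)%type} | A \in [set ind_class p | p : (gT * Z)%type]}.

Definition ind_shift (g : gT) (p : (gT * Z)%type) : (gT * Z)%type := (g * p.1, p.2).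

Lemma ind_shift_class g p : ind_shift g @: ind_class p = ind_class (ind_shift g p).
Proof.
rewrite /ind_class -imset_comp; apply: eq_imset => h /=.
by rewrite /ind_shift /= mulgA.
Qed.

Lemma ind_act_subproof g (A : ind_car) :
  ind_shift g @: val A \in [set ind_class p | p : (gT * Z)%type].
Proof. by case: A => A /= /imsetP[p _ ->]; rewrite ind_shift_class imset_f. Qed.
Definition ind_act g (A : ind_car) : ind_car := 
  Sub (ind_shift g @: val A) (ind_act_subproof g A).
Lemma ind_act1 A : ind_act 1 A = A.
Proof.
apply/val_inj; rewrite /= -[RHS]imset_id; apply: eq_imset => -[g z].
by rewrite /ind_shift /= mul1g.
Qed.
Lemma ind_actM g h A : ind_act (g * h) A = ind_act g (ind_act h A).
Proof.
apply/val_inj; rewrite /= -imset_comp; apply: eq_imset => -[k z].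
by rewrite /ind_shift /= mulgA.
Qed.

Definition gind : gset gT := GSet ind_act1 ind_actM.
End Induction.

End Constructions.

(* Wreath products with symmetric groups. MathComp composes permutations from *)
(* left to right: (t * s) i = s (t i), so s o t is written t * s.             *)

Section Wreath.
Variables (gT : finGroupType) (n : nat).

Record wreath := Wreath { wbase : {ffun 'I_n -> gT}; wperm : {perm 'I_n} }.

Definition wreath_pair w := (wbase w, wperm w).
Definition wreath_of_pair p := Wreath p.1 p.2.
Lemma wreath_pairK : cancel wreath_pair wreath_of_pair. Proof. by case. Qed.
HB.instance Definition _ := Finite.copy wreath (can_type wreath_pairK).

Definition wreath_mul (v w : wreath) : wreath :=
  Wreath [ffun i => wbase v i * wbase w ((wperm v)^-1 i)] (wperm w * wperm v).
Definition wreath_one : wreath := Wreath [ffun=> 1] 1.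
Definition wreath_inv (v : wreath) : wreath :=
  Wreath [ffun i => (wbase v (wperm v i))^-1] (wperm v)^-1.

Lemma wreath_eq v w : wbase v =1 wbase w -> wperm v = wperm w -> v = w.
Proof. by case: v w => [f s] [g t] /= /ffunP-> ->. Qed.

Lemma wreath_mulA : associative wreath_mul.
Proof.
move=> u v w; apply: wreath_eq => [i|] /=; last by rewrite mulgA.
by rewrite !ffunE mulgA invMg permM.
Qed.
Lemma wreath_mul1 : left_id wreath_one wreath_mul.
Proof.
move=> v; apply: wreath_eq => [i|] /=; last by rewrite mulg1.
by rewrite !ffunE invg1 perm1 mul1g.
Qed.
Lemma wreath_mulV : left_inverse wreath_one wreath_inv wreath_mul.
Proof.
move=> v; apply: wreath_eq => [i|] /=; last by rewrite mulgV.
by rewrite !ffunE invgK mulVg.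
Qed.
HB.instance Definition _ :=
  Finite_isGroup.Build wreath wreath_mulA wreath_mul1 wreath_mulV.

Variable X : gset gT.

Definition pow_act (w : wreath) (x : {ffun 'I_n -> X}) : {ffun 'I_n -> X} :=
  [ffun i => gact (wbase w i) (x ((wperm w)^-1 i))].
Lemma pow_act1 x : pow_act 1 x = x.
Proof. by apply/ffunP=> i; rewrite !ffunE gact1 invg1 perm1. Qed.
Lemma pow_actM v w x : pow_act (v * w) x = pow_act v (pow_act w x).
Proof. by apply/ffunP=> i; rewrite !ffunE gactM invMg permM. Qed.

Definition gpow : gset wreath := GSet pow_act1 pow_actM.
End Wreath.

Section Block.
Variables (gT : finGroupType) (i j : nat).

Definition block_fun (s : {perm 'I_i}) (t : {perm 'I_j}) (k : 'I_(i + j)) : 'I_(i + j) :=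
  match fintype.split k with inl u => lshift j (s u) | inr v => rshift i (t v) end.

Lemma block_funK s t : cancel (block_fun s t) (block_fun s^-1 t^-1).
Proof.
move=> k; rewrite {2}/block_fun; case: splitP => [u|v] ku; rewrite /block_fun.
  by rewrite (unsplitK (inl _)) permK; apply/val_inj.
by rewrite (unsplitK (inr _)) permK; apply/val_inj.
Qed.

Definition block_perm s t : {perm 'I_(i + j)} := perm (can_inj (block_funK s t)).

Definition block (p : (wreath gT i * wreath gT j)%type) : wreath gT (i + j) :=
  Wreath [ffun k => match fintype.split k with
                    | inl u => wbase p.1 u
                    | inr v => wbase p.2 v
                    end]
         (block_perm (wperm p.1) (wperm p.2)).

Lemma splitl (u : 'I_i) : fintype.split (lshift j u) = inl u.
Proof. exact: (unsplitK (inl _)). Qed.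
Lemma splitr (v : 'I_j) : fintype.split (rshift i v) = inr v.
Proof. exact: (unsplitK (inr _)). Qed.

Lemma block_permM s t s' t' :
  block_perm (s * s') (t * t') = block_perm s t * block_perm s' t'.
Proof.
apply/permP => k; rewrite -[k]splitK; case: (fintype.split k) => u /=;
  by rewrite permM !permE /block_fun ?(splitl, splitr) permM.
Qed.

Lemma block_permV s t : (block_perm s t)^-1 = block_perm s^-1 t^-1.
Proof.
apply: (mulgI (block_perm s t)); rewrite mulgV -block_permM !mulgV.
apply/permP => k; rewrite -[k]splitK; case: (fintype.split k) => u /=;
  by rewrite !permE /block_fun ?(splitl, splitr) perm1.
Qed.

Lemma blockM : {in [set: (wreath gT i * wreath gT j)%type] &,
  {morph block : p q / p * q}}.
Proof.
move=> [v v'] [w w'] _ _; apply: wreath_eq => /= [k|]; last exact: block_permM.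
rewrite !ffunE block_permV /= -[k]splitK.
by case: (fintype.split k) => u /=;
  rewrite permE /block_fun ?(splitl, splitr) ffunE.
Qed.

Canonical block_morphism := Morphism blockM.
End Block.

Local Close Scope group_scope.

(* Conjugacy classes of subgroups, and the Burnside ring as the free abelian  *)
(* group on its canonical basis: the class C stands for the transitive set of *)
(* cosets of a subgroup in C.                                                 *)

Section Burnside.
Variable gT : finGroupType.

Definition conj_class :=
  {C : {set {group gT}} | C \in [set orbit 'JG [set: gT] H | H : {group gT}]}.
HB.instance Definition _ := SubFinite.on conj_class.

Lemma class_of_subproof (H : {group gT}) :
  orbit 'JG [set: gT] H \in [set orbit 'JG [set: gT] K | K : {group gT}].
Proof. exact: imset_f. Qed.

Definition class_of (H : {group gT}) : conj_class :=
  Sub (orbit 'JG [set: gT] H) (class_of_subproof H).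

Definition class_repr (C : conj_class) : {group gT} :=
  odflt 1%G [pick H in val C].

Lemma class_reprK : cancel class_repr class_of.
Proof.
case=> C CP; apply/val_inj; rewrite /= /class_repr /=.
case/imsetP: (CP) => H _ ->; case: pickP => [K|/(_ H)]; last by rewrite orbit_refl.
by move/orbit_eqP.
Qed.

Definition burnside := {ffun conj_class -> int}.
HB.instance Definition _ := GRing.Zmodule.on burnside.

(* the class [X]: its C-coordinate is the number of orbits of type C *)
Definition gclass (X : gset gT) : burnside :=
  [ffun C => Posz #|[set O in gorbits X | [exists x in O, class_of (gstab x) == C]]|].

Definition burnside_basis (C : conj_class) : gset gT := gcoset (class_repr C).

(* chi : A(Gamma) -> Fun(Conj(Gamma), Z), the additive extension of           *)
(* [X] |-> ([H] |-> |X^H|)                                                    *)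
Definition mark (x : burnside) (C : conj_class) : int :=
  \sum_D x D * Posz #|gfix (burnside_basis D) (class_repr C)|.

Definition burnside_span (S : {set conj_class}) : {pred burnside} :=
  fun x => [forall C, (C \notin S) ==> (x C == 0)].

Lemma burnside_span_closed S : zmod_closed (burnside_span S).
Proof.
split=> [|x y]; first by apply/forallP => C; rewrite ffunE eqxx implybT.
move=> /forallP xS /forallP yS; apply/forallP => C; apply/implyP => CS.
by have /eqP x0 := implyP (xS C) CS; have /eqP y0 := implyP (yS C) CS;
  rewrite !ffunE x0 y0 subrr.
Qed.
HB.instance Definition _ S :=
  GRing.isZmodClosed.Build burnside (burnside_span S) (burnside_span_closed S).

End Burnside.

Section BurnsideFacts.
Variable gT : finGroupType.
Implicit Types (X : gset gT) (H K : {group gT}).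

Lemma mem_gstab X (x : X) g : (g \in gstab x) = (gact g x == x).
Proof.
rewrite -groupV; apply/astab1P/eqP => /=; last by rewrite /= invgK.
by rewrite /= invgK.
Qed.

Lemma mem_gfix X H (x : X) : (x \in gfix X H) = [forall g in H, gact g x == x].
Proof.
apply/afixP/forall_inP => [xH g Hg|xH g Hg] /=; last by apply/eqP/xH; rewrite groupV.
by have /= := xH _ (groupVr Hg); rewrite invgK => ->.
Qed.

Lemma mem_gorbit X (x y : X) :
  (y \in orbit (ract X) [set: gT] x) = [exists g, y == gact g x].
Proof.
apply/imsetP/existsP => [[g _ ->]|[g /eqP ->]]; first by exists g^-1%g.
by exists g^-1%g; rewrite ?inE //= invgK.
Qed.

Lemma gactK X g : cancel (@gact _ X g) (gact g^-1%g).
Proof. by move=> x; rewrite -gactM mulVg gact1. Qed.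

Lemma gactKV X g : cancel (@gact _ X g^-1%g) (gact g).
Proof. by move=> x; rewrite -gactM mulgV gact1. Qed.

Lemma gstab_act X (x : X) g : class_of (gstab (gact g x)) = class_of (gstab x).
Proof.
have e : (gstab (gact g x) :^ g)%G = gstab x.
  apply/val_inj/setP => h; rewrite /= mem_conjg conjgE invgK.
  rewrite -[LHS]/(_ \in gstab (gact g x)) -[RHS]/(h \in gstab x) !mem_gstab.
  by rewrite -gactM -!mulgA mulVg mulg1 gactM (can_eq (@gactK X g)).
apply/val_inj => /=; apply/esym/orbit_eqP.
by rewrite -e; apply: (mem_orbit 'JG); rewrite inE.
Qed.

Lemma coset_of_subproof H g : (g *: H)%g \in lcosets H [set: gT].
Proof. by apply/lcosetsP; exists g; rewrite ?inE. Qed.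
Definition coset_pt H g : gcoset H := Sub (g *: H)%g (coset_of_subproof H g).

Lemma coset_ptP H (A : gcoset H) : {g | A = coset_pt H g}.
Proof.
suff: exists g, A == coset_pt H g by move/sigW => [g /eqP]; exists g.
case: A => A AP; have /lcosetsP[g _ e] := AP.
by exists g; apply/eqP/val_inj.
Qed.

Lemma coset_pt_act H g h : gact g (coset_pt H h) = coset_pt H (g * h)%g.
Proof. by apply/val_inj; rewrite /= lcosetM. Qed.

Lemma coset_pt_eq H g h : (coset_pt H g == coset_pt H h) = (h^-1 * g \in H)%g.
Proof. by rewrite -val_eqE /= (sameP eqP lcoset_eqP) mem_lcoset. Qed.

Lemma gstab_coset H : gstab (coset_pt H 1%g) = H.
Proof.
by apply/val_inj/setP => g; rewrite mem_gstab coset_pt_act coset_pt_eq mulg1 invg1 mul1g.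
Qed.

Lemma gclass_coset H : gclass (gcoset H) = [ffun C => (class_of H == C)%:R].
Proof.
apply/ffunP => C; rewrite !ffunE.
pose O := orbit (ract (gcoset H)) [set: gT] (coset_pt H 1%g).
have OT A : A \in O.
  have [g ->] := coset_ptP A; rewrite mem_gorbit; apply/existsP; exists g.
  by rewrite coset_pt_act mulg1.
have -> : [set O in gorbits (gcoset H) | [exists x in O, class_of (gstab x) == C]]
    = if class_of H == C then [set O] else finset.set0.
  have st (A : gcoset H) : class_of (gstab A) = class_of H.
    have [g ->] := coset_ptP A; rewrite -(mulg1 g) -coset_pt_act gstab_act.
    by rewrite gstab_coset.
  apply/setP => B; rewrite inE; apply/andP/idP.
    case=> /imsetP[A _ ->] /exists_inP[A' _]; rewrite st => ->; rewrite inE.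
    by apply/eqP; apply/orbit_eqP; apply: OT.
  case: ifP => [HC|_]; last by rewrite inE.
  rewrite inE => /eqP ->; split; first exact: imset_f.
  by apply/exists_inP; exists (coset_pt H 1%g); rewrite ?OT ?st.
by case: ifP; rewrite ?cards1 ?cards0.
Qed.

Lemma card_gfix_orbit X (y : X) K :
  #|[set x in gfix X K | orbit (ract X) [set: gT] x == orbit (ract X) [set: gT] y]|
    = #|gfix (gcoset (gstab y)) K|.
Proof.
pose f (A : gcoset (gstab y)) : X := gact (sval (coset_ptP A)) y.
have fE g : f (coset_pt _ g) = gact g y.
  rewrite /f; case: coset_ptP => h /= /eqP; rewrite eq_sym coset_pt_eq mem_gstab.
  by rewrite gactM => /eqP e; rewrite -[LHS](gactKV g) e.
have f_inj : injective f.
  move=> A B; have [[g ->] [h ->]] := (coset_ptP A, coset_ptP B); rewrite !fE => e.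
  by apply/eqP; rewrite coset_pt_eq mem_gstab gactM e gactK.
rewrite -(card_imset _ f_inj); apply: eq_card => x.
rewrite inE; apply/andP/imsetP => [[xK /eqP xy]|[A]].
  have : x \in orbit (ract X) [set: gT] y by rewrite -xy orbit_refl.
  rewrite mem_gorbit => /existsP[g /eqP xg]; exists (coset_pt _ g); rewrite ?fE //.
  rewrite mem_gfix; apply/forall_inP => k Kk; rewrite -(inj_eq f_inj).
  rewrite coset_pt_act !fE gactM -xg; move: xK; rewrite mem_gfix.
  by move/forall_inP/(_ k Kk).
have [g ->] := coset_ptP A; rewrite mem_gfix fE => /forall_inP gK ->; split.
  rewrite mem_gfix; apply/forall_inP => k Kk; rewrite -gactM -!fE (inj_eq f_inj).
  by rewrite -coset_pt_act gK.
by apply/eqP/orbit_eqP; rewrite mem_gorbit; apply/existsP; exists g.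
Qed.

Lemma class_repr_conj H : exists g, (class_repr (class_of H) = H :^ g)%G.
Proof.
have /(congr1 val) /= /orbit_eqP := class_reprK (class_of H).
by case/orbitP => g _ <-; exists g.
Qed.

Lemma card_gfix_class X (y : X) K :
  #|[set x in gfix X K | orbit (ract X) [set: gT] x == orbit (ract X) [set: gT] y]|
    = #|gfix (burnside_basis (class_of (gstab y))) K|.
Proof.
have [g e] := class_repr_conj (gstab y).
have e' : gstab (gact g^-1%g y) = (gstab y :^ g)%G.
  apply/val_inj/setP => h; rewrite /= mem_conjg conjgE invgK.
  rewrite -[LHS]/(_ \in gstab (gact g^-1%g y)) -[RHS]/(_ \in gstab y) !mem_gstab.
  by rewrite !gactM -(can_eq (@gactK X g)) gactKV.
rewrite /burnside_basis e -e' -card_gfix_orbit.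
suff -> : orbit (ract X) [set: gT] (gact g^-1%g y) = orbit (ract X) [set: gT] y by [].
by apply/orbit_eqP; rewrite mem_gorbit; apply/existsP; exists g^-1%g.
Qed.

Lemma mark_gclass X C : mark (gclass X) C = Posz #|gfix X (class_repr C)|.
Proof.
set K := class_repr C.
pose orb := orbit (ract X) [set: gT].
pose ty (O : {set X}) D := [exists x in O, class_of (gstab x) == D].
have tyE y D : ty (orb y) D = (class_of (gstab y) == D).
  apply/exists_inP/idP => [[x]|yD]; last by exists y; rewrite ?orbit_refl.
  by rewrite mem_gorbit => /existsP[g /eqP ->]; rewrite gstab_act.
pose F O : int := \sum_(x in gfix X K | orb x == O) 1.
have FE y : F (orb y) = Posz #|gfix (burnside_basis (class_of (gstab y))) K|.
  rewrite -card_gfix_class -[RHS]natz -sumr_const /F.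
  by apply: eq_bigl => x; rewrite inE.
transitivity (\sum_D \sum_(O in gorbits X | ty O D) F O).
  apply: eq_bigr => D _; rewrite ffunE -[X in X * _]natz mulr_natl -sumr_const.
  apply: eq_big => [O|O]; rewrite !inE // => /andP[/imsetP[y _ ->]].
  by rewrite -/(ty _ _) -/(orb y) tyE FE => /eqP ->.
rewrite (exchange_big_dep (mem (gorbits X))) /=; last by move=> D O _ /andP[].
transitivity (\sum_(O in gorbits X) F O).
  apply: eq_bigr => _ /imsetP[y _ ->]; rewrite -/(orb y).
  rewrite (big_pred1 (class_of (gstab y))) // => D.
  by rewrite imset_f ?inE //= tyE eq_sym.
rewrite -[RHS]natz -sumr_const (partition_big orb (mem (gorbits X))) //.
by move=> x _; apply: imset_f.
Qed.
End BurnsideFacts.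

Section Power.
Variable gT : finGroupType.
Local Notation A n := (burnside (wreath gT n)).

(* the transfer product, biadditive in the canonical bases *)
Definition transfer i j (x : A i) (y : A j) : A (i + j)%N :=
  \sum_C \sum_D
    gclass (gind (block_morphism gT i j)
                 (gprod (burnside_basis C) (burnside_basis D))) *~ (x C * y D).

(* the degree n component of the product of two graded elements *)
Definition transfer_conv (x y : forall n, A n) (n : nat) : A n :=
  \sum_(i < n.+1) ecast m (A m) (subnKC (leq_ord i)) (transfer (x i) (y (n - i)%N)).

Record total_power := TotalPower {
  tpow :> forall n, burnside gT -> A n;
  tpow_class : forall n (X : gset gT), tpow n (gclass X) = gclass (gpow n X);
  tpow0 : forall x, tpow 0%N x = gclass (gunit _);
  tpowD : forall n x y,
    tpow n (x + y) = transfer_conv (tpow^~ x) (tpow^~ y) n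
}.

Variable P : total_power.

(* the smallest subset of the canonical basis of A(G wr Sigma_n) whose span   *)
(* contains the image of P n                                                  *)
Definition power_basis n : {set conj_class (wreath gT n)} :=
  \bigcap_(S : {set conj_class (wreath gT n)}
            | `[< forall x, P n x \in burnside_span S >]) S.

Record power_span n := PowerSpan {
  power_span_val :> A n;
  power_spanP : power_span_val \in burnside_span (power_basis n)
}.
HB.instance Definition _ n := [isSub for @power_span_val n].
HB.instance Definition _ n := [Choice of power_span n by <:].
HB.instance Definition _ n :=
  [SubChoice_isSubZmodule of power_span n by <:].

Lemma tpow_span n x : P n x \in burnside_span (power_basis n).
Proof.
apply/forallP => C; apply/implyP => CS; apply: contraNT CS => PC.
apply/bigcapP => S /asboolP PS; apply: contraNT PC => CS.
exact: implyP (forallP (PS x) C) CS.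
Qed.

Definition tpow_in n x : power_span n := PowerSpan (tpow_span n x).

Definition power_ring := dsum power_span.

Definition power_ring_val (x : power_ring) (n : nat) : A n := power_span_val (x n).

End Power.

Section Parks.
Variable gT : finGroupType.

Definition posnat := {m : nat | (0 < m)%N}.

Definition parts := {fsfun conj_class gT * posnat -> nat with 0%N}.

Definition parts_norm (l : parts) : nat := (\sum_(k <- finsupp l) l k * val k.2)%N.
Definition parts_fact (l : parts) : nat := (\prod_(k <- finsupp l) (l k)`!)%N.

Definition parts_deg (n : nat) := {l : parts | parts_norm l == n}.

Section Coefficients.
Variable R : comNzRingType.

Definition parks_deg (n : nat) := parts_deg n -> R.
HB.instance Definition _ n := GRing.Zmodule.on (parks_deg n).

Definition parks := dsum parks_deg.

Definition parks_eval (f : parks) (l : parts) : R := f (parts_norm l) (exist _ l (eqxx _)).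

Definition parts_splittings (m : parts) : set (parts * parts) :=
  [set p : parts * parts | forall k, (p.1 k + p.2 k)%N = m k]%classic.

Definition parks_conv (f g : parks) (m : parts) : R :=
  \sum_(p \in parts_splittings m)
    (parts_fact m %/ (parts_fact p.1 * parts_fact p.2))%:R
      * parks_eval f p.1 * parks_eval g p.2.

Lemma parts_norm_splitting (m : parts) p :
  parts_splittings m p -> parts_norm m = (parts_norm p.1 + parts_norm p.2)%N.
Proof.
move=> mp.
have norm_sub (l : parts) : (finsupp l `<=` finsupp m)%fset ->
    parts_norm l = (\sum_(k <- finsupp m) l k * val k.2)%N.
  move=> lm; apply: big_fset_incl => // k _; rewrite memNfinsupp => /eqP ->.
  exact: mul0n.
rewrite !norm_sub // -?big_split /=; first by apply: eq_bigr => k _; rewrite -mp mulnDl.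
  by apply/fsubsetP => k; rewrite !mem_finsupp -(mp k) -!lt0n addn_gt0 => ->; rewrite ?orbT.
by apply/fsubsetP => k; rewrite !mem_finsupp -(mp k) -!lt0n addn_gt0 => ->; rewrite ?orbT.
Qed.

Lemma parks_eval0 (f : parks) N (l : parts) :
  (forall n, (N <= n)%N -> f n = 0) -> (N <= parts_norm l)%N -> parks_eval f l = 0.
Proof. by move=> fN lN; rewrite /parks_eval fN. Qed.

Lemma parks_star_subproof (f g : parks) :
  finite_support (fun n (l : parts_deg n) => parks_conv f g (val l)).
Proof.
have [[N fN] [K gK]] := (dsum_finite f, dsum_finite g).
exists (N + K)%N => n NKn; apply/funext => l.
have /eqP mn := valP l; move: (val l) mn => m mn.
apply: fsbig1 => p mp; have := parts_norm_splitting mp; rewrite mn => {mp} pn.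
have [Np|pN] := leqP N (parts_norm p.1).
  by rewrite (parks_eval0 fN) // mulr0 mul0r.
rewrite (parks_eval0 gK) ?mulr0 // leqNgt; apply/negP => pK.
by have := leq_trans (leq_add pN (ltnW pK)) NKn; rewrite addSn -pn ltnn.
Qed.

Definition parks_star (f g : parks) : parks := @DSum parks_deg _ (parks_star_subproof f g).

Definition parks_one : parks := @dsum_in parks_deg 0%N (fun=> 1).

End Coefficients.

(* q (x) f |-> q f, identifying Q (x) Parks(G) with Parks(G, Q) *)
Lemma parks_scale_subproof (q : rat) (f : parks int) :
  finite_support (fun n (l : parts_deg n) => q * (f n l)%:~R).
Proof.
have [N fN] := dsum_finite f; exists N => n /fN fn0.
by apply/funext => l; rewrite fn0 mulr0.
Qed.

Definition parks_scale (q : rat) (f : parks int) : parks rat :=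
  @DSum (parks_deg rat) _ (parks_scale_subproof q f).

Definition parks_scale_deg n (q : rat) (f : parks_deg int n) : parks_deg rat n :=
  fun l => q * (f l)%:~R.

Definition parks_rat : tensor rat (parks int) -> parks rat :=
  tensor_lift parks_scale.

Definition parks_rat_deg n : tensor rat (parks_deg int n) -> parks_deg rat n :=
  tensor_lift (@parks_scale_deg n).

Lemma parks_scale_deg_biadditive n : biadditive (@parks_scale_deg n).
Proof.
split=> [f q q'|q f f']; apply/funext => l; rewrite /parks_scale_deg.
  by rewrite mulrDl.
by have -> : (f + f') l = f l + f' l by []; rewrite rmorphD mulrDr.
Qed.

Lemma parks_scale_biadditive : biadditive parks_scale.
Proof.
split=> [f q q'|q f f']; apply: dsum_eq => n.
  exact: (parks_scale_deg_biadditive n).1.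
exact: (parks_scale_deg_biadditive n).2.
Qed.

HB.instance Definition _ := GRing.isZmodMorphism.Build (tensor rat (parks int)) (parks rat)
  parks_rat (tensor_liftB parks_scale_biadditive).
HB.instance Definition _ n := GRing.isZmodMorphism.Build
  (tensor rat (parks_deg int n)) (parks_deg rat n)
  (@parks_rat_deg n) (tensor_liftB (@parks_scale_deg_biadditive n)).

End Parks.

Section ParksHom.
Variables (gT : finGroupType) (P : total_power gT).

(* The characterization of the parks homomorphism. In parks_homM the product  *)
(* of x and y is taken in the sum of the A(G wr Sigma_n), where it is again   *)
(* an element z of the graded subring spanned by the powers.                  *)
Record is_parks_hom (chi : {additive power_ring P -> parks gT int}) : Prop :=
  IsParksHom {
    parks_hom_graded : forall n (x : power_span P n) m,
      n != m -> chi (dsum_in x) m = 0;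
    parks_hom1 : forall u : power_span P 0,
      power_span_val u = gclass (gunit _) -> chi (dsum_in u) = parks_one gT int;
    parks_homM : forall x y z : power_ring P,
      (forall n, power_ring_val z n = transfer_conv (power_ring_val x) (power_ring_val y) n) ->
      chi z = parks_star (chi x) (chi y);
    parks_hom_power : forall n (x : burnside gT) (l : parts gT),
      parts_norm l = n ->
      parks_eval (chi (dsum_in (tpow_in P n x))) l =
        \prod_(k <- finsupp l) mark x k.1 ^+ l k
  }.

Definition parks_hom_deg (chi : {additive power_ring P -> parks gT int}) n
    (x : power_span P n) : parks_deg gT int n :=
  chi (dsum_in x) n.

Lemma parks_hom_deg_zmod_morphism chi n : zmod_morphism (@parks_hom_deg chi n).
Proof.
move=> x y; rewrite /parks_hom_deg.
have -> : dsum_in (x - y) = dsum_in x - dsum_in y.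
  apply: dsum_eq => m /=; rewrite /dsum_in_fun; case: eqP => [e|_]; last by rewrite subrr.
  by case: _ / e.
by rewrite raddfB.
Qed.
HB.instance Definition _ chi n := GRing.isZmodMorphism.Build
  (power_span P n) (parks_deg gT int n) (@parks_hom_deg chi n)
  (@parks_hom_deg_zmod_morphism chi n).

End ParksHom.

(* Main.v *)
Require Import Defs.
From HB Require Import structures.
From mathcomp Require Import all_boot all_order all_algebra all_fingroup.
From mathcomp Require Import finmap.
From mathcomp Require Import boolp classical_sets fsbigop.
From mathcomp Require Import generic_quotient freeg.

(** The whole argument is integral: it shows that [chi] is injective and that
    every function on parts has a nonzero multiple in its image.  Since every
    element of [tensor rat M] is a pure tensor with a common denominator
    ([tensor_rat_pure]), and likewise every rational function with finite support
    on parts is a fraction of an integral one ([parks_scale_surj]), these two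
    facts give all the rational bijections ([tensor_map_rat_bij]).

    Torsion cokernel.  Call a part generated when its delta function has a
    nonzero multiple in the image.  The star product of two delta functions is a
    nonzero multiple of the delta function of the sum, so generated parts are
    closed under addition, provided that the power ring is closed under the
    transfer product.  By induction on the norm it remains to treat singletons
    [([H], n)].  The image of the power [P n [G/H]] is a combination of delta
    functions whose coefficient at [([K], n)] is the mark of [G/H] at [K].  The
    table of marks is triangular with nonzero diagonal, so modulo decomposable
    parts these images give all singletons ([generated_single]).

    The power ring.  Its canonical basis in degree [n] consists of the types of
    orbits that occur in a power [X ^ n] of some finite set ([power_basisE]): a
    virtual element [x = [X] - [Y]] is reduced to actual powers by the additivity
    formula.  These types are closed under the transfer product, because a point
    of the set induced from orbits of [X ^ i] and [Y ^ j] has the stabiliser of a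
    point of [(X + Y) ^ (i + j)] ([transfer_types]).

    Injectivity.  The type of a point [x] of [X ^ n] is determined by a part of
    norm [n]: for each orbit of [X] met by [x], record the class of its
    stabilisers and the number of coordinates lying in it ([power_part_stab]).
    Hence the degree [n] component of [chi] maps a free group of rank at most the
    number of parts of norm [n] to the functions on these parts.  Having torsion
    cokernel, it is given by a matrix of full row space, which is then square and
    invertible over the rationals ([parks_hom_deg_inj]). *)

Set Implicit Arguments.
Unset Strict Implicit.
Unset Printing Implicit Defensive.

Import Defs GRing.Theory Num.Theory Order.TTheory.
Local Open Scope ring_scope.

(** * The rational tensor product *)

Lemma tens_rat_nat (M : zmodType) (q : rat) (m : M) (n : nat) :
  tens (q *+ n) m = tens q (m *+ n).
Proof.
have [tl tr] := tens_biadditive rat M.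
elim: n => [|n IHn]; last by rewrite !mulrS tl tr IHn.
have z1 : tens (0 : rat) m = 0.
  by apply: (addrI (tens 0 m)); rewrite -tl !addr0.
have z2 : tens q (0 : M) = 0.
  by apply: (addrI (tens q 0)); rewrite -tr !addr0.
by rewrite !mulr0n z1 z2.
Qed.

Lemma tens_rat_int (M : zmodType) (q : rat) (m : M) (z : int) :
  tens (q *~ z) m = tens q (m *~ z).
Proof.
have [tl tr] := tens_biadditive rat M.
have tN (x : rat) (y : M) : tens (- x) y = tens x (- y).
  have tN1 : tens (- x) y = - tens x y.
    apply: (addrI (tens x y)); rewrite -tl !subrr.
    by apply: (addrI (tens (0 : rat) y)); rewrite -tl !addr0.
  rewrite tN1; apply: (addrI (tens x y)); rewrite -tr !subrr.
  by apply/esym; apply: (addrI (tens x (0 : M))); rewrite -tr !addr0.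
case: z => n; first exact: tens_rat_nat.
by rewrite !NegzE !mulrNz tN -!mulNrn -tens_rat_nat.
Qed.

(** A common denominator of the coefficients makes every tensor pure. *)
Lemma tensor_rat_pure (M : zmodType) (t : tensor rat M) :
  exists d : nat, exists m : M, t = tens (d.+1%:R^-1) m.
Proof.
have [tl tr] := tens_biadditive rat M.
pose F := {freeg (rat * M)%type / int}.
pose S (D : F) := exists d : nat, exists m : M,
  (\pi D)%qT = tens (d.+1%:R^-1) m :> tensor rat M.
suff SD (D : F) : S D by rewrite -[t]reprK; apply: SD.
have S0 : S 0.
  exists 0%N, 0; change (0 = tens (1%:R^-1 : rat) (0 : M)).
  by apply/esym; apply: (addrI (tens (1%:R^-1 : rat) (0 : M))); rewrite -tr !addr0.
have SA D1 D2 : S D1 -> S D2 -> S (D1 + D2).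
  move=> [d [m e]] [d' [m' e']].
  have red a b (x : M) : tens (a.+1%:R^-1 : rat) x
      = tens ((a.+1 * b.+1)%N%:R^-1 : rat) (x *+ b.+1).
    rewrite -tens_rat_nat; congr tens.
    by rewrite natrM invfM -[RHS]mulr_natr -mulrA mulVf ?mulr1 // pnatr_eq0.
  exists (d.+1 * d'.+1).-1, (m *+ d'.+1 + m' *+ d.+1).
  rewrite prednK ?muln_gt0 // tr -red mulnC -red -e -e'.
  by rewrite -[RHS]/(tensor_add _ _) tensor_pi_add.
have SN D1 : S D1 -> S (- D1).
  move=> [d [m e]]; exists d, (- m).
  have := tens_rat_int (d.+1%:R^-1) m (-1); rewrite !mulrN1z => <-.
  apply: (addrI (tens d.+1%:R^-1 m)).
  rewrite -tl subrr -e -[LHS]/(tensor_add _ _) tensor_pi_add subrr.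
  by apply/esym; apply: (addrI (tens (0 : rat) m)); rewrite -tl !addr0.
(* the denominator of [q] becomes the scalar, its numerator acts on [m] *)
have SP (u : rat * M) : S << u >>.
  case: u => q m; have := denq_gt0 q; have := divq_num_den q.
  case: (denq q) => [[|d]|] // qE _.
  exists d, (m *~ numq q).
  rewrite -tens_rat_int -[LHS]/(tens q m); congr tens.
  by rewrite -{1}qE mulrC mulrzr.
have Sn u n : S (<< u >> *+ n) by elim: n => // n IHn; rewrite mulrS; apply: (SA).
rewrite -[D]freeg_sumE; elim/big_rec: _ => // u D' _; apply: SA.
rewrite -[coeff u D]intz -freegU_mulz.
by case: (coeff u D) => n; [apply: Sn|apply/SN/Sn].
Qed.

(** Every tensor being pure, injectivity has to be checked on pure tensors only. *)
Lemma tensor_rat_lift_bij (M W : zmodType) (b : rat -> M -> W) :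
    biadditive b -> (forall q m, q != 0 -> b q m = 0 -> m = 0) ->
  (forall w, exists q m, w = b q m) -> bijective (tensor_lift b).
Proof.
move=> bb b0 bs.
have inj : injective (tensor_lift b).
  move=> s t st; apply/eqP; rewrite -subr_eq0; apply/eqP.
  have : tensor_lift b (s - t) = 0 by rewrite tensor_liftB // st subrr.
  have [d [m ->]] := tensor_rat_pure (s - t).
  rewrite tensor_lift_tens // => /b0 ->; last by rewrite invr_eq0 pnatr_eq0.
  have [_ tr] := tens_biadditive rat M.
  by apply: (addrI (tens (d.+1%:R^-1 : rat) (0 : M))); rewrite -tr !addr0.
pose g w : tensor rat M := let: exist q qP := cid (bs w) in
  let: exist m mP := cid qP in tens q m.
have gK : cancel g (tensor_lift b).
  by move=> w; rewrite /g; case: cid => q qP; case: cid => m ->; rewrite tensor_lift_tens.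
by exists g => // t; apply: inj; rewrite gK.
Qed.

(** A homomorphism into a group on which the rationals act through [b]
    becomes bijective after rationalisation when it is injective with torsion
    cokernel. *)
Lemma tensor_map_rat_bij (M V W : zmodType) (f : {additive M -> V})
    (b : rat -> V -> W) (bb : biadditive b) :
    (forall q v, q != 0 -> b q v = 0 -> v = 0) ->
    injective f ->
    (forall w, exists q m, w = b q (f m)) ->
  bijective (tensor_lift b \o tensor_map (@idfun rat) f).
Proof.
move=> b0 finj fs.
have bf : biadditive (fun q m => b q (f m)).
  have [bl br] := bb.
  by split=> [m q q'|q m m'] /=; rewrite ?raddfD ?bl ?br.
have : bijective (tensor_lift (fun q m => b q (f m))).
  apply: tensor_rat_lift_bij => // q m q0 /(b0 _ _ q0) fm.
  by apply: finj; rewrite fm raddf0.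
move/eq_bij; apply => t; have [d [m ->]] := tensor_rat_pure t.
by rewrite /= tensor_lift_tens // tensor_map_tens tensor_lift_tens.
Qed.

(** * Functions on parts *)

Lemma parks_evalE (gT : finGroupType) (R : comNzRingType) (f : parks gT R) n
    (l : parts_deg gT n) :
  parks_eval f (val l) = f n l.
Proof.
case: l => l ln; have e := eqP ln; move: ln; rewrite -{}e => ln /=.
by rewrite /parks_eval; congr (f _ (exist _ _ _)); apply: bool_irrelevance.
Qed.

Lemma parks_ext (gT : finGroupType) (R : comNzRingType) (f g : parks gT R) :
  (forall l, parks_eval f l = parks_eval g l) -> f = g.
Proof.
by move=> fg; apply: dsum_eq => n; apply/funext => l; rewrite -!parks_evalE.
Qed.

Lemma parts_le_norm (gT : finGroupType) (l : parts gT) k :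
  (l k * val k.2 <= parts_norm l)%N.
Proof.
have [kl|/fsfun_dflt ->] := boolP (k \in finsupp l); last by rewrite mul0n.
by rewrite /parts_norm (big_fsetD1 k) //= leq_addr.
Qed.

(** An entry of a part of norm [n] is at most [n] and sits at some [m <= n], so
    the part is recorded by a function between finite types. *)
Lemma parts_deg_finite (gT : finGroupType) n :
  exists s : seq (parts_deg gT n), forall l, l \in s.
Proof.
(* the places [(C, 0)] correspond to no entry and carry a dummy value *)
pose F := {ffun conj_class gT * 'I_n.+1 -> 'I_n.+1}.
pose e (l : parts_deg gT n) : F := [ffun k =>
  if insub (val k.2) is Some m then inord (val l (k.1, m)) else ord0].
have e_inj : injective e.
  move=> l l' ll; apply/val_inj/fsfunP => -[C m].
  have small (l0 : parts_deg gT n) (m' : posnat) : (n < val m')%N -> val l0 (C, m') = 0%N.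
    move=> nm; have := parts_le_norm (val l0) (C, m'); rewrite (eqP (valP l0)) /=.
    case: (val l0 _) => // k; rewrite leqNgt => /negP[].
    by apply: leq_trans nm _; rewrite mulSn leq_addr.
  have [mn|nm] := leqP (val m) n; last by rewrite !small.
  have := congr1 (fun f : F => f (C, inord (val m))) ll.
  rewrite !ffunE /= inordK // valK => /(congr1 val) /=.
  have bnd (l0 : parts_deg gT n) : (val l0 (C, m) < n.+1)%N.
    have := parts_le_norm (val l0) (C, m); rewrite (eqP (valP l0)) ltnS /=.
    by apply: leq_trans; rewrite leq_pmulr // (valP m).
  by rewrite !inordK; [|exact: bnd|exact: bnd].
pose g (f : F) := if pselect (exists l, e l = f) is left h then [:: projT1 (cid h)] else [::].
exists (flatten [seq g f | f <- enum F]) => l; apply/flatten_mapP.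
exists (e l); rewrite ?mem_enum // /g; case: pselect => [h|[]]; last by exists l.
by case: cid => l' /= /e_inj ->; rewrite inE.
Qed.

Lemma parts_norm_finite (gT : finGroupType) N :
  exists s : seq (parts gT), forall l, (parts_norm l < N)%N -> l \in s.
Proof.
elim: N => [|N [s sP]]; first by exists [::].
have [t tP] := parts_deg_finite gT N.
exists (map val t ++ s) => l; rewrite ltnS leq_eqVlt mem_cat => /predU1P[lN|/sP ->].
  apply/orP; left; have lN' : parts_norm l == N by apply/eqP.
  by apply/mapP; exists (Sub l lN').
exact: orbT.
Qed.

Lemma common_denominator (I : eqType) (s : seq I) (w : I -> rat) :
  exists d : nat, {in s, forall i, exists z : int, w i = d.+1%:R^-1 * z%:~R}.
Proof.
elim: s => [|i s [d dP]]; first by exists 0%N.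
have [e [y ye]] : exists e : nat, exists y : int, w i = e.+1%:R^-1 * y%:~R.
  have := denq_gt0 (w i); have := divq_num_den (w i).
  by case: (denq (w i)) => [[|e]|] // <- _; exists e, (numq (w i)); rewrite mulrC.
exists (d.+1 * e.+1).-1 => j; rewrite prednK ?muln_gt0 // natrM invfM inE.
case/predU1P => [->|/dP[z ->]].
  exists (y * d.+1%:Z); rewrite ye rmorphM /= [d.+1%:R^-1 * _]mulrC -mulrA.
  by congr (_ * _); rewrite [y%:~R * _]mulrC mulrA mulVf ?mul1r ?pnatr_eq0.
exists (z * e.+1%:Z); rewrite rmorphM /= mulrACA.
by rewrite [_ * (e.+1%:Z)%:~R]mulVf ?mulr1 ?pnatr_eq0.
Qed.

Lemma parks_scale_eq0 (gT : finGroupType) q (f : parks gT int) :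
  q != 0 -> parks_scale q f = 0 -> f = 0.
Proof.
move=> q0 f0; apply: dsum_eq => n; apply/funext => l.
have /eqP : parks_scale q f n l = 0 by rewrite f0.
by rewrite mulf_eq0 (negPf q0) intr_eq0 => /eqP.
Qed.

Lemma parks_scale_surj (gT : finGroupType) (w : parks gT rat) :
  exists q f, w = parks_scale q f.
Proof.
have [N wN] := dsum_finite w; have [s sP] := parts_norm_finite gT N.
have [d dP] := common_denominator s (parks_eval w).
(* asking for zero in high degrees makes the numerators finitely supported *)
have /choice[F FP] l : exists z : int, parks_eval w l = d.+1%:R^-1 * z%:~R
    /\ ((N <= parts_norm l)%N -> z = 0).
  have [lN|lN] := ltnP (parts_norm l) N; first by have [z ->] := dP _ (sP _ lN); exists z.
  by exists 0; rewrite (parks_eval0 wN) ?mulr0.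
have F0 : @finite_support (parks_deg gT int) (fun n l => F (val l)).
  by exists N => n nN; apply/funext => l; rewrite (FP _).2 // (eqP (valP l)).
exists d.+1%:R^-1, (DSum F0 : parks gT int); apply: dsum_eq => n; apply/funext => l.
by rewrite -parks_evalE (FP _).1.
Qed.

Lemma parks_scale_deg_eq0 (gT : finGroupType) n q (f : parks_deg gT int n) :
  q != 0 -> parks_scale_deg q f = 0 -> f = 0.
Proof.
move=> q0 f0; apply/funext => l.
have /eqP : parks_scale_deg q f l = 0 by rewrite f0.
by rewrite mulf_eq0 (negPf q0) intr_eq0 => /eqP.
Qed.

Lemma parks_scale_deg_surj (gT : finGroupType) n (w : parks_deg gT rat n) :
  exists q f, w = parks_scale_deg q f.
Proof.
have [s sP] := parts_deg_finite gT n; have [d dP] := common_denominator s w.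
have /choice[F FP] l := dP l (sP l).
by exists d.+1%:R^-1, F; apply/funext => l; rewrite FP.
Qed.

Lemma parks_rat_bij (gT : finGroupType) : bijective (@parks_rat gT).
Proof.
apply: tensor_rat_lift_bij; first exact: parks_scale_biadditive.
  exact: parks_scale_eq0.
exact: parks_scale_surj.
Qed.

(** * The star product of delta functions *)

Section PartsDelta.
Variable gT : finGroupType.
Implicit Types (a b l m : parts gT) (f g : parks gT int).

(** Evaluation with the part as first argument, an additive map to which
    [raddf_sum] and [raddfMz] apply. *)
Definition parks_at l f : int := parks_eval f l.

Lemma parks_at_zmod_morphism l : zmod_morphism (parks_at l).
Proof. by []. Qed.
HB.instance Definition _ l := GRing.isZmodMorphism.Build (parks gT int) int
  (parks_at l) (@parks_at_zmod_morphism l).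

Lemma parks_at_ext f g : (forall l, parks_at l f = parks_at l g) -> f = g.
Proof. exact: parks_ext. Qed.

Lemma parks_delta_finite a :
  @finite_support (parks_deg gT int) (fun n (l : parts_deg gT n) => (val l == a)%:R).
Proof.
exists (parts_norm a).+1 => n an; apply/funext => l; case: eqP => // la.
by have := an; rewrite -la (eqP (valP l)) ltnn.
Qed.

Definition parks_delta a : parks gT int := DSum (parks_delta_finite a).

Lemma parks_at_delta a l : parks_at l (parks_delta a) = (l == a)%:R.
Proof. by []. Qed.

Definition parts_add a b : parts gT :=
  [fsfun k in (finsupp a `|` finsupp b)%fset => (a k + b k)%N].

Lemma parts_addE a b k : parts_add a b k = (a k + b k)%N.
Proof.
rewrite fsfunE; case: ifP => //; rewrite !inE !mem_finsupp => /norP[].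
by rewrite !negbK => /eqP -> /eqP ->.
Qed.

Lemma parts_norm_add a b : parts_norm (parts_add a b) = (parts_norm a + parts_norm b)%N.
Proof. by apply: (@parts_norm_splitting _ _ (a, b)) => k; rewrite parts_addE. Qed.

(** Entry by entry the quotient is a binomial coefficient. *)
Lemma parts_fact_add a b :
  (parts_fact a * parts_fact b %| parts_fact (parts_add a b))%N.
Proof.
set m := parts_add a b.
have sub l : (finsupp l `<=` finsupp m)%fset ->
    parts_fact l = (\prod_(k <- finsupp m) (l k)`!)%N.
  by move=> lm; apply: big_fset_incl => // k _; rewrite memNfinsupp => /eqP ->.
rewrite (sub a) ?(sub b) ?(sub m) ?fsubset_refl -?big_split //=; last 2 first.
- by apply/fsubsetP => k; rewrite !mem_finsupp parts_addE -!lt0n addn_gt0 => ->; rewrite ?orbT.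
- by apply/fsubsetP => k; rewrite !mem_finsupp parts_addE -!lt0n addn_gt0 => ->; rewrite ?orbT.
elim/big_rec2: _ => // k x y _ yx; apply: dvdn_mul => //.
rewrite parts_addE -(bin_fact (leq_addr (b k) (a k))) addKn.
exact: dvdn_mull.
Qed.

(** The pair [(a, b)] is the only splitting that contributes, and only to
    [a + b]. *)
Lemma parks_star_delta a b (c d : int) :
  parks_star (parks_delta a *~ c) (parks_delta b *~ d) =
    parks_delta (parts_add a b) *~
      ((parts_fact (parts_add a b) %/ (parts_fact a * parts_fact b))%:R * c * d).
Proof.
have ev m e l : parks_eval (parks_delta m *~ e) l = if l == m then e else 0.
  rewrite [LHS](raddfMz (parks_at l)) -[X in X *~ _]/((l == m)%:R : int).
  by case: eqP => _; rewrite ?mul0rz // intz.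
apply: parks_at_ext => m; rewrite /parks_at ev.
rewrite [LHS]/(parks_conv _ _ m) /parks_conv.
have [->|mab] := eqVneq.
  rewrite -(@fsbig_widen _ _ _ _ [set (a, b)]%classic).
  - by rewrite fsbig_set1 /= !ev !eqxx.
  - by move=> _ ->  k /=; rewrite parts_addE.
  - move=> -[p q] [_ /= pq]; rewrite !ev.
    by case: eqP pq => [->|_]; case: eqP => [->|_] //; rewrite ?mulr0 ?mul0r.
apply: fsbig1 => -[p q] /= pq; rewrite !ev.
case: eqP pq => [->|_ _]; last by rewrite mulr0 mul0r.
case: eqP => [->|_ _]; last by rewrite mulr0.
by move=> ab; case/eqP: mab; apply/fsfunP => k; rewrite parts_addE ab.
Qed.

Definition parts_nil : parts gT := [fsfun].

Definition parts_single k : parts gT := [fsfun parts_nil with k |-> 1%N]%function.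

Lemma parts_singleE k j : parts_single k j = (j == k).
Proof. by rewrite fsfun_withE fsfun0E; case: eqP. Qed.

Lemma parts_norm_nil : parts_norm parts_nil = 0%N.
Proof. by rewrite /parts_norm finsupp0 big_seq_fset0. Qed.

Lemma parts_norm_eq0 l : parts_norm l = 0%N -> l = parts_nil.
Proof.
move=> l0; apply/fsfunP => k; rewrite fsfun0E.
have := parts_le_norm l k; rewrite l0 leqn0 muln_eq0 => /orP[/eqP //|/eqP k0].
by have := valP k.2; rewrite /= k0.
Qed.

Lemma finsupp_single k : finsupp (parts_single k) = [fset k]%fset.
Proof.
by apply/fsetP => j; rewrite mem_finsupp parts_singleE inE; case: (j == k).
Qed.

Lemma parts_norm_single k : parts_norm (parts_single k) = val k.2.
Proof. by rewrite /parts_norm finsupp_single big_seq_fset1 parts_singleE eqxx mul1n. Qed.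

(** Taking one unit off a nonzero entry; this drives the induction that obtains
    all delta functions from those of singletons. *)
Lemma parts_decomp l : [\/ l = parts_nil, exists k, l = parts_single k |
  exists a b, [/\ l = parts_add a b, parts_norm a < parts_norm l &
               parts_norm b < parts_norm l]%N].
Proof.
have [->|ln] := eqVneq l parts_nil; first by constructor 1.
have [l0|[k kl]] := fset_0Vmem (finsupp l).
  by case/eqP: ln; apply/fsfunP => k; rewrite fsfun0E fsfun_dflt // l0.
rewrite mem_finsupp -lt0n in kl.
pose b : parts gT := [fsfun l with k |-> (l k).-1]%function.
have lab : l = parts_add (parts_single k) b.
  apply/fsfunP => j; rewrite parts_addE parts_singleE /b fsfun_withE.
  by case: eqP => [->|] //; rewrite add1n prednK.
have [b0|bn] := eqVneq b parts_nil.
  constructor 2; exists k; rewrite lab b0.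
  by apply/fsfunP => j; rewrite parts_addE fsfun0E addn0.
constructor 3; exists (parts_single k), b; split=> //.
  rewrite lab parts_norm_add -[X in (X < _)%N]addn0 ltn_add2l.
  by rewrite lt0n; apply: contraNneq bn => /parts_norm_eq0 ->.
rewrite lab parts_norm_add -[X in (X < _)%N]add0n ltn_add2r.
by rewrite parts_norm_single (valP k.2).
Qed.

End PartsDelta.

(** * Classes of finite sets *)

Section GSets.
Variable gT : finGroupType.
Implicit Types (X Y : gset gT) (C D : conj_class gT) (H K : {group gT}).

Lemma class_of_conj H K : class_of H = class_of K -> exists g, (K = H :^ g)%G.
Proof.
move/(congr1 val) => /= /esym/orbit_eqP /orbitP[g _ e].
by exists g; rewrite -e.
Qed.

Lemma gstab_gactV X (x : X) g : (gstab (gact g^-1 x) = gstab x :^ g)%G.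
Proof.
apply/val_inj/setP => h; rewrite /= mem_conjg conjgE invgK.
rewrite -[LHS]/(_ \in gstab (gact g^-1%g x)) -[RHS]/(_ \in gstab x) !mem_gstab.
by rewrite !gactM -(can_eq (@gactK _ X g)) gactKV.
Qed.

Lemma gclass_stab X (x : X) : gclass X (class_of (gstab x)) != 0.
Proof.
rewrite ffunE -[X in _ != X]/(Posz 0) eqz_nat -lt0n; apply/card_gt0P.
exists (orbit (ract X) [set: gT] x); rewrite inE; apply/andP; split.
  by apply: imset_f; rewrite inE.
by apply/exists_inP; exists x; rewrite ?orbit_refl.
Qed.

Lemma gclass_span X (S : {set conj_class gT}) :
  (forall x : X, class_of (gstab x) \in S) -> gclass X \in burnside_span S.
Proof.
move=> XS; apply/forallP => C; apply/implyP; apply: contraNT.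
rewrite ffunE -[X in _ != X]/(Posz 0) eqz_nat -lt0n => /card_gt0P[O].
by rewrite inE => /andP[_ /exists_inP[x _ /eqP <-]].
Qed.

(** Orbits of one type have the same size, so counting points of that type
    counts the orbits. *)
Lemma card_stab_type X C :
  Posz #|[set x : X | class_of (gstab x) == C]| =
    gclass X C * Posz #|[set: gT] : class_repr C|%g.
Proof.
rewrite ffunE -PoszM; congr Posz.
pose orb := orbit (ract X) [set: gT].
rewrite -sum_nat_const -sum1_card.
pose typed (O : {set X}) := [exists x in O, class_of (gstab x) == C].
rewrite (partition_big orb [in [set O in gorbits X | typed O]]) /=; last first.
  move=> x; rewrite !inE => xC; rewrite imset_f ?inE //=.
  by apply/exists_inP; exists x; rewrite ?orbit_refl.
apply: eq_bigr => O; rewrite inE => /andP[/imsetP[y _ ->] /exists_inP[x xy /eqP xC]].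
have yC : class_of (gstab y) = C.
  by move: xy; rewrite mem_gorbit => /existsP[g /eqP xg]; rewrite -xC xg gstab_act.
have stab_card K : class_of K = C -> #|K| = #|class_repr C|.
  move=> KC; have [g ->] : exists g, (class_repr C = K :^ g)%G.
    by apply: class_of_conj; rewrite KC class_reprK.
  by rewrite cardJg.
transitivity #|orb y|.
  rewrite -sum1_card; apply: eq_bigl => z; rewrite inE /=.
  apply/andP/idP => [[_ /eqP/orbit_eqP //]|zy].
  split; last exact/eqP/orbit_eqP.
  by move: zy; rewrite mem_gorbit => /existsP[g /eqP ->]; rewrite gstab_act yC.
have e : (#|orb y| * #|gstab y|)%N = #|[set: gT]|.
  rewrite -(card_orbit_stab (ract X) [set: gT]%G y); congr (_ * _)%N.
  by apply: eq_card => g; rewrite [RHS]inE finset.in_setT.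
apply/eqP; rewrite -(eqn_pmul2r (cardG_gt0 (gstab y))) e.
by rewrite (stab_card _ yC) mulnC Lagrange ?finset.subsetT.
Qed.

Section Sum.
Variables X Y : gset gT.
Definition sum_act (g : gT) (z : X + Y) : X + Y :=
  match z with inl x => inl (gact g x) | inr y => inr (gact g y) end.
Lemma sum_act1 z : sum_act 1%g z = z.
Proof. by case: z => z /=; rewrite gact1. Qed.
Lemma sum_actM g h z : sum_act (g * h)%g z = sum_act g (sum_act h z).
Proof. by case: z => z /=; rewrite gactM. Qed.
Definition gsum : gset gT := GSet sum_act1 sum_actM.
End Sum.

(** Points are easier to add than orbits: the orbits of a type are counted by
    the points of that type. *)
Lemma gclass_sum X Y : gclass (gsum X Y) = gclass X + gclass Y.
Proof.
apply/ffunP => C; rewrite [RHS]ffunE.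
have Ipos : Posz #|[set: gT] : class_repr C|%g != 0.
  by rewrite -[X in _ != X]/(Posz 0) eqz_nat -lt0n indexg_gt0.
apply: (mulIf Ipos); rewrite mulrDl -!card_stab_type -PoszD; congr Posz.
have stl (x : X) : gstab (inl x : gsum X Y) = gstab x.
  by apply/val_inj/setP => g; rewrite !mem_gstab.
have str (y : Y) : gstab (inr y : gsum X Y) = gstab y.
  by apply/val_inj/setP => g; rewrite !mem_gstab.
rewrite -!sum1_card big_sumType /=; congr addn; apply: eq_bigl => x.
  by rewrite !inE stl.
by rewrite !inE str.
Qed.

Definition gempty : gset gT := @GSet gT void (fun _ x => x) (fun=> erefl) (fun _ _ _ => erefl).

Lemma gclass_empty X : (X -> False) -> gclass X = 0.
Proof.
move=> X0; apply/ffunP => C; rewrite !ffunE; congr Posz; apply: eq_card0 => O.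
by rewrite inE; apply/negP => /andP[/imsetP[x]]; case: (X0 x).
Qed.

(** Every element is a difference of two sets, put in the additive form to which
    [tpowD] applies. *)
Lemma burnside_virtual (x : burnside gT) :
  exists X Y, x + gclass Y = gclass X.
Proof.
pose V (z : burnside gT) := exists X Y, z + gclass Y = gclass X.
have VD a b : V a -> V b -> V (a + b).
  move=> [X [Y e]] [X' [Y' e']]; exists (gsum X X'), (gsum Y Y').
  by rewrite !gclass_sum addrACA e e'.
have V0 : V 0 by exists gempty, gempty; rewrite add0r.
have VN a : V a -> V (- a).
  by move=> [X [Y e]]; exists Y, X; rewrite -e addKr.
have VX X : V (gclass X).
  by exists X, gempty; rewrite [gclass gempty]gclass_empty ?addr0.
have -> : x = \sum_C gclass (burnside_basis C) *~ x C.
  apply/ffunP => D; rewrite sum_ffunE (bigD1 D) //= big1 ?addr0 => [|C CD].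
    by rewrite ffunMzE gclass_coset ffunE class_reprK eqxx intz.
  by rewrite ffunMzE gclass_coset ffunE class_reprK (negPf CD) mul0rz.
elim/big_rec: _ => // C y _; apply: (VD).
have Vn n : V (gclass (burnside_basis C) *+ n).
  by elim: n => // n IHn; rewrite mulrS; apply: (VD).
by case: (x C) => n; [apply: Vn|apply/VN/Vn].
Qed.

End GSets.

(** * Stabilisers in powers and the transfer product *)

Section InducedStabiliser.
Variables (gT hT : finGroupType) (phi : {morphism [set: hT] >-> gT}) (Z : gset hT).
Local Open Scope group_scope.

Lemma ind_class_act g z h : gact h z = z ->
  ind_class phi (g * phi h, z : Z) = ind_class phi (g, z).
Proof.
move=> hz; have sub g' h' : gact h' z = z ->
    {subset ind_class phi (g' * phi h', z : Z) <= ind_class phi (g', z)}.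
  move=> hz' p /imsetP[k _ ->]; apply/imsetP; exists (k * h'^-1); first by [].
  rewrite /= morphM ?inE // morphV ?inE // invMg invgK mulgA; congr (_, _).
  by rewrite gactM -[in X in _ = gact k X]hz' gactK.
apply/setP => p; apply/idP/idP; first exact: sub.
have hz' : gact h^-1 z = z by rewrite -[in LHS]hz gactK.
move=> pg; apply: (sub _ _ hz').
by rewrite -mulgA -morphM ?inE // mulgV morph1 mulg1.
Qed.

Lemma gind_stabP (A : gind phi Z) g z w : val A = ind_class phi (g, z) ->
  reflect (exists2 h, w * g = g * phi h & gact h z = z) (gact w A == A).
Proof.
move=> Ae; have wA : val (gact w A) = ind_class phi (w * g, z).
  by rewrite /= Ae ind_shift_class.
apply: (iffP eqP) => [/(congr1 val)|[h wg hz]]; last first.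
  by apply/val_inj; rewrite wA Ae wg ind_class_act.
rewrite wA Ae => e; have : (w * g, z) \in ind_class phi (w * g, z).
  by apply/imsetP; exists 1; rewrite //= morph1 invg1 mulg1 gact1.
rewrite e => /imsetP[h _ [wg hz]]; exists h^-1.
  by rewrite wg morphV ?inE.
by rewrite [in LHS]hz gactK.
Qed.
End InducedStabiliser.

Section PowerTypes.
Variable gT : finGroupType.

(** By [power_basisE] below, these types are the canonical basis of the degree
    [n] part of the power ring, for every choice of the power operations. *)
Definition power_types n : {set conj_class (wreath gT n)} :=
  [set C | `[< exists (X : gset gT) (x : gpow n X), class_of (gstab x) = C >]].

Lemma power_types_gstab n (X : gset gT) (x : gpow n X) :
  class_of (gstab x) \in power_types n.
Proof. by rewrite inE; apply/asboolP; exists X, x. Qed.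

Lemma gclass_power_types n (X : gset gT) :
  gclass (gpow n X) \in burnside_span (power_types n).
Proof. by apply: gclass_span => x; apply: power_types_gstab. Qed.

Lemma power_types_repr n C : C \in power_types n ->
  exists (X : gset gT) (x : gpow n X), gstab x = class_repr C.
Proof.
rewrite inE => /asboolP[X [x xC]]; exists X.
have [g e] := class_repr_conj (gstab x); rewrite xC in e.
by exists (gact g^-1%g x); rewrite gstab_gactV e.
Qed.

Section Join.
Variables (i j : nat) (X Y : gset gT).

Definition power_join (x : gpow i X) (y : gpow j Y) : gpow (i + j) (gsum X Y) :=
  [ffun k => match fintype.split k with inl u => inl (x u) | inr v => inr (y v) end].

Lemma power_joinl x y u : power_join x y (lshift j u) = inl (x u).
Proof. by rewrite ffunE splitl. Qed.

Lemma power_joinr x y u : power_join x y (rshift i u) = inr (y u).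
Proof. by rewrite ffunE Defs.splitr. Qed.

Lemma power_join_block p x y :
  gact (block p) (power_join x y) = power_join (gact p.1 x) (gact p.2 y).
Proof.
apply/ffunP => k; rewrite !ffunE /= block_permV -[k]splitK.
by case: (fintype.split k) => u /=;
  rewrite permE /block_fun !(splitl, Defs.splitr) /= !ffunE.
Qed.

Lemma perm_of_blocks (s : {perm 'I_(i + j)}) :
    (forall k, (s k < i)%N = (k < i)%N) ->
  exists s1 s2, s = block_perm s1 s2.
Proof.
move=> si.
have sl (u : 'I_i) : {v : 'I_i | s (lshift j u) = lshift j v}.
  have h : (s (lshift j u) < i)%N by rewrite si /= ltn_ord.
  by exists (Ordinal h); apply/val_inj.
have sr (u : 'I_j) : {v : 'I_j | s (rshift i u) = rshift i v}.
  have h : (i <= s (rshift i u))%N by rewrite leqNgt si /= -leqNgt leq_addr.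
  have h' : (s (rshift i u) - i < j)%N by rewrite ltn_subLR.
  by exists (Ordinal h'); apply/val_inj; rewrite /= subnKC.
have inj1 : injective (fun u => sval (sl u)).
  move=> u v /=; case: (sl u) (sl v) => [u' eu] [v' ev] /= e.
  by apply: (@lshift_inj i j); apply: (@perm_inj _ s); rewrite eu ev e.
have inj2 : injective (fun u => sval (sr u)).
  move=> u v /=; case: (sr u) (sr v) => [u' eu] [v' ev] /= e.
  by apply: (@rshift_inj i j); apply: (@perm_inj _ s); rewrite eu ev e.
exists (perm inj1), (perm inj2); apply/permP => k; rewrite permE /block_fun.
rewrite -[in LHS](splitK k); case: (fintype.split k) => u; rewrite permE /=.
  by case: (sl u).
by case: (sr u).
Qed.

(** A stabilising element cannot exchange the coordinates in [X] with those in
    [Y], so it is a block element. *)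
Lemma power_join_stab x y w :
  reflect (exists2 p, w = block p & gact p.1 x = x /\ gact p.2 y = y)
          (gact w (power_join x y) == power_join x y).
Proof.
apply: (iffP eqP) => [wxy|[p -> [px py]]]; last by rewrite power_join_block px py.
have jE z : (match power_join x y z with inl _ => true | inr _ => false end) = (z < i)%N.
  by rewrite ffunE; case: fintype.splitP.
have /perm_of_blocks[s1 [s2 sE]] k : (wperm w k < i)%N = (k < i)%N.
  have := congr1 (fun f : {ffun 'I_(i + j) -> gsum X Y} => f (wperm w k)) wxy.
  by rewrite /= [LHS]ffunE permK -!jE => <-; case: (power_join x y k).
pose p := (Wreath [ffun u => wbase w (lshift j u)] s1,
           Wreath [ffun v => wbase w (rshift i v)] s2).
have wp : w = block p.
  apply: wreath_eq => [k|]; last by [].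
  rewrite ffunE -[in LHS](splitK k); case: (fintype.split k) => u /=.
    by rewrite ffunE.
  by rewrite ffunE.
exists p => //; move: wxy; rewrite wp power_join_block => /ffunP e.
split; apply/ffunP => u.
  by have := e (lshift j u); rewrite !power_joinl => -[].
by have := e (rshift i u); rewrite !power_joinr => -[].
Qed.
End Join.

(** The stabiliser of a point of the induced set is that of a juxtaposition of
    points of [X ^ i] and [Y ^ j] in [(X + Y) ^ (i + j)]. *)
Lemma transfer_types i j C D : C \in power_types i -> D \in power_types j ->
  gclass (gind (block_morphism gT i j) (gprod (burnside_basis C) (burnside_basis D)))
    \in burnside_span (power_types (i + j)).
Proof.
move=> /power_types_repr[X [x xC]] /power_types_repr[Y [y yD]].
apply: gclass_span => A; have /imsetP[[g [a b]] _ Ae] := valP A.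
have [h ah] := coset_ptP a; have [k bk] := coset_ptP b.
have := power_types_gstab (gact g (power_join (gact h x) (gact k y))).
suff -> : gstab A = gstab (gact g (power_join (gact h x) (gact k y))) by [].
apply/val_inj/setP => w; rewrite -[LHS]/(w \in gstab A).
rewrite -[RHS]/(w \in gstab (gact g (power_join (gact h x) (gact k y)))) !mem_gstab.
have stC (r : wreath gT i) : (gact r a == a) = (gact r (gact h x) == gact h x).
  rewrite ah coset_pt_act coset_pt_eq -xC mem_gstab !gactM.
  by rewrite -(can_eq (@gactK _ (gpow i X) h)) gactKV.
have stD (r : wreath gT j) : (gact r b == b) = (gact r (gact k y) == gact k y).
  rewrite bk coset_pt_act coset_pt_eq -yD mem_gstab !gactM.
  by rewrite -(can_eq (@gactK _ (gpow j Y) k)) gactKV.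
have -> : (gact w (gact g (power_join (gact h x) (gact k y)))
    == gact g (power_join (gact h x) (gact k y))) =
    (gact (g^-1 * w * g)%g (power_join (gact h x) (gact k y))
      == power_join (gact h x) (gact k y)).
  by rewrite -[RHS](can_eq (gactK g)) -!gactM !mulgA mulgV mul1g.
apply/(gind_stabP _ Ae)/power_join_stab => -[r].
  move=> wg [ra rb]; exists r; first by rewrite -mulgA wg mulKg.
  by split; apply/eqP; [rewrite -stC|rewrite -stD]; apply/eqP.
move=> wg [rx ry]; exists r; first by rewrite -[block_morphism _ _ _ _]wg !mulgA mulgV mul1g.
by congr pair; apply/eqP; rewrite /= ?stC ?stD ?rx ?ry.
Qed.

Lemma transfer_span i j x y :
    x \in burnside_span (power_types i) -> y \in burnside_span (power_types j) ->
  transfer x y \in burnside_span (power_types (i + j)).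
Proof.
move=> xS yS; apply: rpred_sum => C _; apply: rpred_sum => D _.
have [Ci|/(implyP (forallP xS C))/eqP ->] := boolP (C \in power_types i); last first.
  by rewrite mul0r mulr0z rpred0.
have [Dj|/(implyP (forallP yS D))/eqP ->] := boolP (D \in power_types j); last first.
  by rewrite mulr0 mulr0z rpred0.
by rewrite rpredMz // transfer_types.
Qed.

Lemma ecast_span m n (e : m = n) (x : burnside (wreath gT m)) :
  (ecast k (burnside (wreath gT k)) e x \in burnside_span (power_types n)) =
    (x \in burnside_span (power_types m)).
Proof. by case: _ / e. Qed.

Lemma transfer_conv_span (x y : forall n, burnside (wreath gT n)) n :
    (forall m, x m \in burnside_span (power_types m)) ->
    (forall m, y m \in burnside_span (power_types m)) ->
  transfer_conv x y n \in burnside_span (power_types n).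
Proof.
by move=> xS yS; apply: rpred_sum => i _; rewrite ecast_span transfer_span.
Qed.

End PowerTypes.

(** * The basis of the power ring *)

Section PowerBasis.
Variables (gT : finGroupType) (P : total_power gT).

Lemma transfer0r i j x : @transfer gT i j x 0 = 0.
Proof. by rewrite /transfer big1 // => C _; rewrite big1 // => D _; rewrite ffunE mulr0 mulr0z. Qed.

Lemma transfer0l i j x : @transfer gT i j 0 x = 0.
Proof. by rewrite /transfer big1 // => C _; rewrite big1 // => D _; rewrite ffunE mul0r mulr0z. Qed.

Lemma ecast_burnside0 m n (e : m = n) :
  ecast k (burnside (wreath gT k)) e 0 = 0.
Proof. by case: _ / e. Qed.

Lemma tpow_zero n : (0 < n)%N -> P n 0 = 0.
Proof.
move=> n0; have -> : 0 = gclass (gempty gT) by rewrite gclass_empty.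
rewrite tpow_class gclass_empty // => x; by case: (x (Ordinal n0)).
Qed.

(** Writing [x + [Y] = [X]], the additivity formula expresses [P n x] through
    [P n [X]] and transfer products of lower powers, its last summand being
    [P n x] times the unit.  That this product is again [P n x] is the
    additivity formula for [x + 0]. *)
Lemma tpow_power_types n x : P n x \in burnside_span (power_types gT n).
Proof.
have [k] := ubnP n; elim: k n x => // k IHk n x; rewrite ltnS => nk.
have [X [Y xXY]] := burnside_virtual x.
pose t y (i : 'I_n.+1) := ecast m (burnside (wreath gT m)) (subnKC (leq_ord i))
  (transfer (P i x) (P (n - i)%N y)).
have tD y : P n (x + y) = \sum_i t y i by rewrite tpowD.
have last_term y : t y ord_max = P n x.
  (* the degree zero power is the unit, whatever it is a power of *)
  have -> : t y ord_max = t 0 ord_max.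
    rewrite /t; have P0 m : m = 0%N -> P m y = P m 0 by move=> ->; rewrite !tpow0.
    by rewrite P0 //= subnn.
  rewrite -[x in RHS]addr0 tD (bigD1 ord_max) //= big1 ?addr0 // => i i_max.
  rewrite /t tpow_zero ?transfer0r ?ecast_burnside0 // subn_gt0.
  by rewrite ltn_neqAle -ltnS ltn_ord andbT.
have := tD (gclass Y); rewrite xXY tpow_class (bigD1 ord_max) //= last_term => e.
rewrite -[P n x](addrK (\sum_(i | i != ord_max) t (gclass Y) i)) -e.
apply: rpredB; first exact: gclass_power_types.
apply: rpred_sum => i i_max; rewrite ecast_span transfer_span //.
  apply: IHk; apply: leq_trans nk.
  by rewrite ltn_neqAle -ltnS ltn_ord andbT.
by rewrite tpow_class gclass_power_types.
Qed.

(** The type of [x] in [X ^ n] occurs in [P n [X]], so no span containing the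
    image of [P n] can omit it. *)
Lemma power_basisE n : power_basis P n = power_types gT n.
Proof.
apply/eqP; rewrite finset.eqEsubset; apply/andP; split.
  apply: (finset.bigcap_inf (power_types gT n)) => //; apply/asboolP => x.
  exact: tpow_power_types.
apply/fintype.subsetP => C; rewrite inE => /asboolP[X [x xC]].
apply/finset.bigcapP => S /asboolP/(_ (gclass X)); rewrite tpow_class => /forallP/(_ C).
by apply: contraTT => CS; rewrite CS /= -xC gclass_stab.
Qed.

Lemma power_ring_closed (x y : power_ring P) : exists z : power_ring P,
  forall n, power_ring_val z n = transfer_conv (power_ring_val x) (power_ring_val y) n.
Proof.
have val_span (u : power_ring P) m : power_ring_val u m \in burnside_span (power_types gT m).
  by rewrite -power_basisE; apply: power_spanP.
have zP n : transfer_conv (power_ring_val x) (power_ring_val y) n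
    \in burnside_span (power_basis P n).
  by rewrite power_basisE transfer_conv_span.
have z0 : finite_support (fun n => PowerSpan (zP n) : power_span P n).
  have [[N xN] [K yK]] := (dsum_finite x, dsum_finite y).
  exists (N + K)%N => n NKn; apply/val_inj => /=.
  apply: big1 => i _; rewrite /power_ring_val.
  have [Ni|iN] := leqP N i.
    by rewrite xN // transfer0l ecast_burnside0.
  rewrite yK ?transfer0r ?ecast_burnside0 //.
  by rewrite leq_subRL ?leq_ord // (leq_trans _ NKn) // leq_add2r ltnW.
by exists (DSum z0).
Qed.

End PowerBasis.

(** * Delta functions are torsion modulo the image *)

(** A fixed coset of [class_repr C] conjugates the subgroup that fixes it into
    [class_repr C]; hence the table of marks is triangular for the order of
    subgroups. *)
Lemma mark_coset_triangular (gT : finGroupType) (C D : conj_class gT) :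
    mark (gclass (burnside_basis C)) D != 0 ->
  D = C \/ (#|class_repr D| < #|class_repr C|)%N.
Proof.
rewrite mark_gclass -[X in _ != X]/(Posz 0) eqz_nat -lt0n => /card_gt0P[A].
have [g ->] := coset_ptP A; rewrite mem_gfix => /forall_inP gK.
have DC : (class_repr D :^ g)%g \subset class_repr C.
  apply/fintype.subsetP => x; rewrite mem_conjg => /gK.
  by rewrite coset_pt_act coset_pt_eq conjgE invgK -!mulgA mulVg mulg1 mulKg.
have := subset_leq_card DC; rewrite cardJg leq_eqVlt => /orP[/eqP e|]; last by right.
left; rewrite -[D]class_reprK -[C]class_reprK; apply/val_inj/esym/orbit_eqP => /=.
have -> : class_repr C = (class_repr D :^ g)%G.
  by apply/val_inj/esym/eqP; rewrite /= eqEcard cardJg e leqnn andbT.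
by apply: (mem_orbit 'JG); rewrite inE.
Qed.

Lemma mark_coset_diag (gT : finGroupType) (C : conj_class gT) :
  mark (gclass (burnside_basis C)) C != 0.
Proof.
rewrite mark_gclass -[X in _ != X]/(Posz 0) eqz_nat -lt0n; apply/card_gt0P.
exists (coset_pt (class_repr C) 1%g); rewrite mem_gfix; apply/forall_inP => g gC.
by rewrite coset_pt_act coset_pt_eq mulg1 invg1 mul1g.
Qed.

Section Generation.
Variables (gT : finGroupType) (P : total_power gT).
Variables (chi : {additive power_ring P -> parks gT int}) (chiP : is_parks_hom chi).

Definition torsion_image (f : parks gT int) :=
  exists2 d : int, d != 0 & exists x, chi x = f *~ d.

Lemma torsion_imageD f g : torsion_image f -> torsion_image g -> torsion_image (f + g).
Proof.
move=> [d d0 [x xf]] [e e0 [y yg]]; exists (d * e); first by rewrite mulf_neq0.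
exists (x *~ e + y *~ d); rewrite raddfD !raddfMz xf yg mulrzDl.
by rewrite -!mulrzA [e * d]mulrC.
Qed.

Lemma torsion_image_mulz f z : torsion_image f -> torsion_image (f *~ z).
Proof.
move=> [d d0 [x xf]]; exists d => //; exists (x *~ z).
by rewrite raddfMz xf -!mulrzA mulrC.
Qed.

Lemma torsion_image_divz f z : z != 0 -> torsion_image (f *~ z) -> torsion_image f.
Proof.
move=> z0 [d d0 [x xf]]; exists (z * d); first by rewrite mulf_neq0.
by exists x; rewrite xf -mulrzA.
Qed.

Lemma torsion_image0 : torsion_image 0.
Proof. by exists 1 => //; exists 0; rewrite raddf0 mul0rz. Qed.

Lemma torsion_image_sum (I : Type) (s : seq I) (F : I -> parks gT int) :
  (forall i, torsion_image (F i)) -> torsion_image (\sum_(i <- s) F i).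
Proof.
move=> IF; elim/big_rec: _ => [|i f _]; first exact: torsion_image0.
exact: torsion_imageD.
Qed.

(** Only finitely many parts meet the support, so a function is a finite
    combination of delta functions. *)
Lemma parks_delta_sum (f : parks gT int) :
  exists2 s : seq (parts gT), uniq s & f = \sum_(l <- s) parks_delta l *~ parks_at l f.
Proof.
have [N fN] := dsum_finite f; have [s sP] := parts_norm_finite gT N.
exists (undup s); first exact: undup_uniq.
apply: parks_at_ext => l; rewrite raddf_sum.
have E l' : parks_at l (parks_delta l' *~ parks_at l' f) = if l' == l then parks_at l f else 0.
  rewrite raddfMz -[X in X *~ _]/((l == l')%:R : int) eq_sym.
  by case: eqP => [->|_]; rewrite ?mul0rz // intz.
rewrite (eq_bigr _ (fun l' _ => E l')) -big_mkcond /=.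
have [ls|ls] := boolP (l \in undup s).
  by rewrite -big_filter filter_pred1_uniq ?undup_uniq // big_seq1.
have l0 : parks_at l f = 0.
  by apply: (parks_eval0 fN); rewrite leqNgt; apply: contra ls => /sP; rewrite mem_undup.
by rewrite big1 // => l' _; rewrite l0.
Qed.

Definition generated (l : parts gT) := torsion_image (parks_delta l).

Lemma torsion_image_finite f :
  (forall l, parks_at l f != 0 -> generated l) -> torsion_image f.
Proof.
move=> fg; have [s _ ->] := parks_delta_sum f; apply: torsion_image_sum => l.
have [->|/fg] := eqVneq (parks_at l f) 0; first exact: torsion_image0.
exact: torsion_image_mulz.
Qed.

(** Subtracting what [f] owes to the generated points leaves a nonzero multiple
    of the delta function at [a]. *)
Lemma generated_remaining f a : torsion_image f -> parks_at a f != 0 ->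
  (forall l, l != a -> parks_at l f != 0 -> generated l) -> generated a.
Proof.
move=> fI fa fg; apply: (torsion_image_divz fa).
rewrite -(subKr f (parks_delta a *~ parks_at a f)).
apply: torsion_imageD => //; rewrite -[X in torsion_image X]mulrN1z.
apply: torsion_image_mulz; apply: torsion_image_finite => l.
rewrite raddfB raddfMz -[X in X *~ _]/((l == a)%:R : int).
have [->|la] := eqVneq l a; first by rewrite intz subrr eqxx.
by rewrite mul0rz subr0; apply: fg.
Qed.

(** The delta function at the zero part is the unit of the star product. *)
Lemma generated_nil : generated (parts_nil gT).
Proof.
have uP : gclass (gunit (wreath gT 0)) \in burnside_span (power_basis P 0).
  by rewrite -(tpow0 P 0); apply: tpow_span.
exists 1 => //; exists (dsum_in (PowerSpan uP)).
rewrite (parks_hom1 chiP) // mulr1z; apply: dsum_eq => n; apply/funext => l.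
have [n0|n0] := eqVneq 0%N n; last first.
  rewrite dsum_in_neq // /=; case: eqP => // ln.
  by have := eqP (valP l); rewrite /= ln parts_norm_nil => /eqP; rewrite (negPf n0).
case: _ / n0 l => l; rewrite dsum_in_id /=.
by have /parts_norm_eq0 := eqP (valP l) => /= ->; rewrite eqxx.
Qed.

(** The star product of two delta functions is a nonzero multiple of a third. *)
Lemma generated_add a b : generated a -> generated b -> generated (parts_add a b).
Proof.
move=> [d d0 [x xa]] [e e0 [y yb]]; have [z zP] := power_ring_closed x y.
have K0 : (parts_fact (parts_add a b) %/ (parts_fact a * parts_fact b))%:R != 0 :> int.
  rewrite pnatr_eq0 -lt0n divn_gt0 ?muln_gt0 /parts_fact; last first.
    by apply/andP; split; apply: prodn_gt0 => k; apply: fact_gt0.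
  by apply: dvdn_leq (parts_fact_add a b); apply: prodn_gt0 => k; apply: fact_gt0.
have := parks_homM chiP zP; rewrite xa yb parks_star_delta => zE.
apply: ex_intro2 (ex_intro _ z zE).
by rewrite !mulf_neq0.
Qed.

(** The image of the power of [burnside_basis C] is nonzero at the singleton
    part of [C].  Its other support points are decomposable, hence generated by
    lower degrees, or singletons at smaller subgroups by triangularity. *)
Lemma generated_single C (m : posnat) :
    (forall l, (parts_norm l < val m)%N -> generated l) ->
  generated (parts_single (C, m)).
Proof.
move=> IHm; have [k Ck] := ubnP #|class_repr C|.
elim: k C Ck => // k IHk C; rewrite ltnS => Ck.
pose n := val m; pose x := gclass (burnside_basis C).
have ev l : parts_norm l = n ->
    parks_at l (chi (dsum_in (tpow_in P n x))) = \prod_(k <- finsupp l) mark x k.1 ^+ l k.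
  exact: (parks_hom_power chiP).
apply: (@generated_remaining (chi (dsum_in (tpow_in P n x)))).
- by exists 1 => //; exists (dsum_in (tpow_in P n x)); rewrite mulr1z.
- rewrite ev ?parts_norm_single // finsupp_single big_seq_fset1 parts_singleE eqxx.
  exact: mark_coset_diag.
move=> l lC; have [ln|ln] := eqVneq (parts_norm l) n; last first.
  by rewrite /parks_at /parks_eval (parks_hom_graded chiP) ?eqxx // eq_sym.
rewrite ev //; case: (parts_decomp l) => [l0|[[D j] lE]|[a [b [lE al bl]]]] l_neq0.
- by rewrite l0; apply: generated_nil.
- have jm : j = m by apply/val_inj; rewrite /= -/n -ln lE parts_norm_single.
  subst j; rewrite lE; apply: IHk; apply: leq_trans Ck.
  move: l_neq0; rewrite lE finsupp_single big_seq_fset1 parts_singleE eqxx.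
  case/mark_coset_triangular => [/= DC|//].
  case/negP: lC; apply/eqP; rewrite lE.
  by apply: (congr1 (fun E => parts_single (E, m))); exact: DC.
- by rewrite lE; apply: generated_add; apply: IHm; rewrite -/n -ln.
Qed.

Lemma parts_generated l : generated l.
Proof.
have [n] := ubnP (parts_norm l); elim: n l => // n IHn l; rewrite ltnS => ln.
case: (parts_decomp l) => [->|[[C m] e]|[a [b [e al bl]]]].
- exact: generated_nil.
- rewrite e; apply: generated_single => l' l'm; apply: IHn.
  by apply: leq_trans l'm _; rewrite -[val m]/(val (C, m).2) -parts_norm_single -e.
- by rewrite e; apply: generated_add; apply: IHn; apply: leq_trans ln.
Qed.

Lemma parks_torsion_image f : torsion_image f.
Proof. by apply: torsion_image_finite => l _; apply: parts_generated. Qed.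

End Generation.

(** * The part of a point of a power *)

Lemma perm_of_perm_eq (T : eqType) n (f g : 'I_n -> T) :
    perm_eq [tuple f i | i < n] [tuple g i | i < n] ->
  exists s : {perm 'I_n}, forall i, f i = g (s i).
Proof.
case/tuple_permP => s e; exists s => i.
have /(congr1 (fun t => tnth t i)) : [tuple f i | i < n]
   = [tuple tnth [tuple g j | j < n] (s i) | i < n] by apply: val_inj.
by rewrite !tnth_mktuple.
Qed.

Lemma perm_of_fibres n (f g : 'I_n -> 'I_n) :
    (forall k, #|[set i | f i == k]| = #|[set i | g i == k]|) ->
  exists s : {perm 'I_n}, forall i, f i = g (s i).
Proof.
move=> fg; apply: perm_of_perm_eq; apply/allP => k _ /=; apply/eqP.
have cnt (h : 'I_n -> 'I_n) : count_mem k [tuple h i | i < n] = #|[set i | h i == k]|.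
  rewrite /= count_map -sum1_card -sum1_count big_enum_cond /=.
  by apply: eq_bigl => i; rewrite inE.
by rewrite !cnt.
Qed.

(** The sizes determine how often [None] occurs. *)
Lemma perm_eq_pmap (T : eqType) (s t : seq (option T)) :
  size s = size t -> perm_eq (pmap id s) (pmap id t) -> perm_eq s t.
Proof.
move=> st pst.
have split_none (u : seq (option T)) :
    perm_eq u (map some (pmap id u) ++ nseq (size u - size (pmap id u)) None).
  have E1 : map some (pmap id u) = filter isSome u by rewrite pmapS_filter map_id.
  have E2 : filter (predC isSome) u = nseq (size u - size (pmap id u)) None.
    have -> : (size u - size (pmap id u))%N = size (filter (predC isSome) u).
      by rewrite size_pmap size_filter -(count_predC isSome u) addKn.
    by apply/all_pred1P/allP => -[k|]; rewrite mem_filter.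
  by rewrite E1 -E2 perm_sym; apply/permPl/perm_filterC.
rewrite (permPl (split_none s)) (permPr (split_none t)).
by rewrite st (perm_size pst) perm_cat2r; apply: perm_map.
Qed.

Section PartsOfSeq.
Variable gT : finGroupType.
Local Notation key := (conj_class gT * posnat)%type.

Definition parts_of_seq (s : seq key) : parts gT :=
  \big[@parts_add gT/parts_nil gT]_(k <- s) parts_single k.

Lemma parts_of_seqE s k : parts_of_seq s k = count_mem k s.
Proof.
have nilE : parts_nil gT k = 0%N by rewrite fsfun0E.
rewrite /parts_of_seq -sum1_count [RHS]big_mkcond /=.
rewrite (big_morph (fun l : parts gT => l k) (fun a b => parts_addE a b k) nilE).
by apply: eq_bigr => j _; rewrite parts_singleE eq_sym; case: eqP.
Qed.

Lemma parts_of_seq_perm s t : parts_of_seq s = parts_of_seq t -> perm_eq s t.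
Proof. by move=> st; apply/allP => k _ /=; rewrite -!parts_of_seqE st. Qed.

Lemma parts_norm_of_seq s : parts_norm (parts_of_seq s) = (\sum_(k <- s) val k.2)%N.
Proof.
rewrite /parts_of_seq (big_morph _ (@parts_norm_add gT) (parts_norm_nil gT)).
by apply: eq_bigr => k _; rewrite parts_norm_single.
Qed.
End PartsOfSeq.

Section CanonicalPoint.
Variables (gT : finGroupType) (X : gset gT).
Implicit Types p q : X.
Local Notation orb p := (orbit (ract X) [set: gT] p).

(** Since [pick] looks at the orbit and the class alone, points of one orbit are
    sent to the same point. *)
Definition canon p : X :=
  odflt p [pick q in orb p | gstab q == class_repr (class_of (gstab p))].

Lemma canonP p : canon p \in orb p /\ gstab (canon p) = class_repr (class_of (gstab p)).
Proof.
rewrite /canon; case: pickP => [q /andP[qp /eqP e] //|h].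
have [g e] := class_repr_conj (gstab p).
have := h (gact g^-1%g p); rewrite mem_gorbit.
have -> /= : [exists g0, gact g^-1%g p == gact g0 p] by apply/existsP; exists g^-1%g.
by rewrite gstab_gactV e eqxx.
Qed.

Lemma class_orbit p q : q \in orb p -> class_of (gstab q) = class_of (gstab p).
Proof. by rewrite mem_gorbit => /existsP[g /eqP ->]; rewrite gstab_act. Qed.

Lemma canon_orbit p q : q \in orb p -> canon q = canon p.
Proof.
move=> qp; have qc := class_orbit qp.
have e : orb q = orb p by apply/orbit_eqP.
rewrite /canon; have eqp : [pick r in orb q | gstab r == class_repr (class_of (gstab q))]
   = [pick r in orb p | gstab r == class_repr (class_of (gstab p))].
  by apply: eq_pick => r; rewrite qc e.
rewrite eqp; case: pickP => // h.
have [cp cs] := canonP p; by have := h (canon p); rewrite /= cp cs eqxx.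
Qed.

Lemma canon_act g p q :
  (gact g (canon p) == canon q) = (q \in orb p) && (g \in class_repr (class_of (gstab q))).
Proof.
have [cp sp] := canonP p; have [cq sq] := canonP q.
have [qp|qp] /= := boolP (q \in orb p).
  by rewrite -sq (canon_orbit qp) mem_gstab.
apply: contraNF qp => /eqP e; move: cq cp; rewrite -e !mem_gorbit.
move=> /existsP[h /eqP hq] /existsP[k /eqP kp]; apply/existsP.
by exists (h^-1 * g * k)%g; rewrite !gactM -kp hq gactK.
Qed.
End CanonicalPoint.

Section PowerPart.
Variables (gT : finGroupType) (n : nat) (X : gset gT) (x : gpow n X).
Local Notation orb p := (orbit (ract X) [set: gT] p).

(** The coordinates of [x] fall into blocks according to their orbit in [X]; the
    root is an index chosen from the block. *)
Definition block_root (i : 'I_n) : 'I_n := odflt i [pick j | x j \in orb (x i)].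

Lemma block_root_orbit i : x (block_root i) \in orb (x i).
Proof. by rewrite /block_root; case: pickP => // _; apply: orbit_refl. Qed.

Lemma block_root_eq i j : (block_root i == block_root j) = (x j \in orb (x i)).
Proof.
apply/eqP/idP => [e|ji].
  have /orbit_eqP ei := block_root_orbit i; have /orbit_eqP ej := block_root_orbit j.
  by apply/orbit_eqP; apply: etrans (esym ej) _; rewrite -e.
have e : orb (x j) = orb (x i) by apply/orbit_eqP.
have eqp : [pick k | x k \in orb (x i)] = [pick k | x k \in orb (x j)].
  by apply: eq_pick => k; rewrite e.
by rewrite /block_root eqp; case: pickP => // /(_ j); rewrite orbit_refl.
Qed.

Definition block_size (k : 'I_n) := #|[set i | block_root i == k]|.

Lemma block_size_root i : (0 < block_size (block_root i))%N.
Proof. by apply/card_gt0P; exists i; rewrite inE. Qed.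

(** Indices that are not roots head no block and have no key. *)
Definition block_key (k : 'I_n) : option (conj_class gT * posnat) :=
  omap (pair (class_of (gstab (x k)))) (insub (block_size k)).

(** The sum, over the orbits of [X] met by [x], of the singletons at the class of
    their stabilisers and the number of coordinates of [x] in them. *)
Definition power_part : parts gT := parts_of_seq (pmap id [tuple block_key k | k < n]).

Lemma parts_norm_power_part : parts_norm power_part = n.
Proof.
rewrite parts_norm_of_seq big_pmap /= big_map big_enum /=.
transitivity (\sum_(k < n) block_size k)%N.
  apply: eq_bigr => k _; rewrite /block_key; case: insubP => [m _ <-|] //=.
  by rewrite lt0n negbK => /eqP ->.
transitivity (\sum_(i < n) 1)%N; last by rewrite sum1_card card_ord.
rewrite [RHS](partition_big block_root predT) //=.
by apply: eq_bigr => k _; rewrite /block_size -sum1_card; apply: eq_bigl => i; rewrite inE.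
Qed.

(** The base group moves each coordinate independently within its orbit. *)
Lemma gstab_canon :
  class_of (gstab ([ffun i => canon (x i)] : gpow n X)) = class_of (gstab x).
Proof.
have /boolp.choice[g gE] i : exists g, canon (x i) = gact g (x i).
  have [] := canonP (x i); by rewrite mem_gorbit => /existsP[g /eqP ->] _; exists g.
rewrite -(gstab_act x (Wreath [ffun i => g i] 1%g)); congr (class_of (gstab _)).
by apply/ffunP => i; rewrite !ffunE /= invg1 perm1 ?ffunE gE.
Qed.

(** The right hand side knows [X] only through the blocks and the classes of the
    stabilisers: this is what makes points of different sets comparable. *)
Lemma mem_gstab_canon (w : wreath gT n) :
  (w \in gstab ([ffun i => canon (x i)] : gpow n X)) =
    [forall i, (block_root (wperm w i) == block_root i) &&
       (wbase w (wperm w i) \in class_repr (class_of (gstab (x (wperm w i)))))].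
Proof.
rewrite mem_gstab; apply/eqP/forallP => [/ffunP e i|wi].
  have := e (wperm w i); rewrite !ffunE permK ?ffunE => /eqP; rewrite canon_act.
  by rewrite eq_sym block_root_eq.
apply/ffunP => i; rewrite !ffunE; apply/eqP; rewrite canon_act.
by have := wi ((wperm w)^-1%g i); rewrite permKV eq_sym block_root_eq.
Qed.

End PowerPart.

(** Equal parts match the blocks of equivalent coordinates of [x] and [y] in
    size and in stabiliser class.  A permutation realising this matching takes
    [x] and [y], made canonical orbit by orbit, to points with literally the
    same stabiliser. *)
Lemma power_part_stab (gT : finGroupType) n (X Y : gset gT) (x : gpow n X) (y : gpow n Y) :
  power_part x = power_part y -> class_of (gstab x) = class_of (gstab y).
Proof.
move/parts_of_seq_perm/perm_eq_pmap; rewrite !size_tuple => /(_ erefl).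
case/perm_of_perm_eq => phi phiE.
have size_phi k : block_size x k = block_size y (phi k).
  have := congr1 (oapp (fun m : conj_class gT * posnat => val m.2) 0%N) (phiE k).
  have sz (Z : gset gT) (z : gpow n Z) j : 
      oapp (fun m : conj_class gT * posnat => val m.2) 0%N (block_key z j) = block_size z j.
    rewrite /block_key; case: insubP => [m _ <-|] //=.
    by rewrite lt0n negbK => /eqP ->.
  by rewrite !sz.
have class_phi i : class_of (gstab (x (block_root x i)))
    = class_of (gstab (y (phi (block_root x i)))).
  have := phiE (block_root x i); rewrite /block_key -size_phi.
  by rewrite (insubT (leq 1) (block_size_root x i)) => -[e]; apply/val_inj.
(* [phi] maps roots to roots; lift it to all coordinates *)
have [s sE] : exists s : {perm 'I_n}, forall i, phi (block_root x i) = block_root y (s i).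
  apply: perm_of_fibres => k; rewrite -[RHS]/(block_size y k) -[k](permKV phi) -size_phi.
  by apply: eq_card => i; rewrite !inE (inj_eq perm_inj).
have class_s i : class_of (gstab (x i)) = class_of (gstab (y (s i))).
  rewrite -(class_orbit (block_root_orbit x i)) class_phi sE.
  exact: class_orbit (block_root_orbit y (s i)).
have root_s i j : (block_root x i == block_root x j)
    = (block_root y (s i) == block_root y (s j)).
  by rewrite -!sE (inj_eq perm_inj).
rewrite -gstab_canon -[RHS]gstab_canon.
(* the pure permutation [s^-1] reindexes [y] along [s] *)
rewrite -(@gstab_act _ (gpow n Y) [ffun i => canon (y i)] (Wreath [ffun=> 1%g] s^-1%g)).
set y' := gact _ _.
have y'E : y' = [ffun i => canon (y (s i))].
  by apply/ffunP => i; rewrite !ffunE gact1 invgK ?ffunE.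
congr class_of; apply/val_inj/setP => w.
rewrite -[LHS]/(w \in gstab ([ffun i => canon (x i)] : gpow n X)).
rewrite -[RHS]/(w \in gstab (y' : gpow n Y)).
pose y2 : gpow n Y := [ffun i => y (s i)].
have -> : y' = [ffun i => canon (y2 i)] by rewrite y'E; apply/ffunP => i; rewrite !ffunE.
have y2s i : y2 i = y (s i) by rewrite ffunE.
rewrite !mem_gstab_canon; apply: eq_forallb => i.
by rewrite class_s !block_root_eq !y2s -!block_root_eq root_s.
Qed.

(** Take the part of some point of the given type; [power_part_stab] says that
    the part remembers the type. *)
Lemma power_types_parts (gT : finGroupType) n :
  exists f : conj_class (wreath gT n) -> parts_deg gT n,
    {in power_types gT n &, injective f}.
Proof.
have [l0] : inhabited (parts_deg gT n).
  pose x : gpow n (gunit gT) := [ffun=> tt].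
  by constructor; exists (power_part x); rewrite parts_norm_power_part.
have /boolp.choice[f fP] (C : conj_class (wreath gT n)) : exists l : parts_deg gT n,
    C \in power_types gT n -> exists (X : gset gT) (x : gpow n X),
      class_of (gstab x) = C /\ power_part x = val l.
  have [|_] := boolP (C \in power_types gT n); last by exists l0.
  rewrite inE => /asboolP[X [x xC]].
  have xn : parts_norm (power_part x) == n by rewrite parts_norm_power_part.
  by exists (exist (fun l => parts_norm l == n) _ xn) => _; exists X, x.
exists f => C D /fP[X [x [<- xf]]] /fP[Y [y [<- yf]]] fe.
by apply: power_part_stab; rewrite xf yf fe.
Qed.

(** * Injectivity by comparison of ranks *)

Section DirectSumFacts.
Variable M : nat -> zmodType.
Implicit Types x y : dsum M.

Lemma dsum_sumE (I : Type) (r : seq I) (F : I -> dsum M) n :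
  (\sum_(i <- r) F i) n = \sum_(i <- r) F i n.
Proof. exact: (big_morph (fun x : dsum M => x n)). Qed.

Lemma dsum_decomp x : exists N, x = \sum_(i < N) dsum_in (x i).
Proof.
have [N xN] := dsum_finite x; exists N; apply: dsum_eq => n; rewrite dsum_sumE.
have [Nn|nN] := leqP N n.
  rewrite xN // big1 // => i _; rewrite dsum_in_neq // neq_ltn.
  by rewrite (leq_trans (ltn_ord i) Nn).
transitivity (\sum_(i < N) if i == Ordinal nN then x n else 0).
  by rewrite -big_mkcond big_pred1_eq.
apply: eq_bigr => i _; case: eqP => [->|/eqP ni]; first by rewrite (dsum_in_id (x n)).
by rewrite dsum_in_neq.
Qed.

End DirectSumFacts.

Lemma parks_degMz (gT : finGroupType) n (f : parks_deg gT int n) z l :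
  (f *~ z) l = f l *~ z.
Proof.
have fn k : (f *+ k) l = f l *+ k by elim: k => // k IHk; rewrite !mulrS -IHk.
by case: z => k; [apply: fn|rewrite !NegzE !mulrNz -[RHS]/(- (f l *+ k.+1)) -fn].
Qed.

Section ParksHomComponents.
Variables (gT : finGroupType) (P : total_power gT).
Variables (chi : {additive power_ring P -> parks gT int}) (chiP : is_parks_hom chi).

Lemma parks_hom_component (x : power_ring P) n :
  chi x n = parks_hom_deg chi (x n).
Proof.
have [N xE] := dsum_decomp x; rewrite [in LHS]xE raddf_sum dsum_sumE.
have big (y : power_ring P) : \sum_(i < N) chi (dsum_in (y i)) n
    = \sum_(i < N) if n == i then parks_hom_deg chi (y n) else 0.
  apply: eq_bigr => i _; case: eqP => [->//|/eqP ni].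
  by rewrite (parks_hom_graded chiP) // eq_sym.
rewrite big; have [Nn|nN] := leqP N n; last first.
  by rewrite -big_mkcond /= (big_pred1 (Ordinal nN)) // => i; rewrite -val_eqE eq_sym.
rewrite big1 => [|i _]; last by rewrite gtn_eqF // (leq_trans (ltn_ord i)).
have -> : x n = 0.
  rewrite xE dsum_sumE big1 // => i _.
  by rewrite dsum_in_neq // neq_ltn (leq_trans (ltn_ord i) Nn).
by rewrite raddf0.
Qed.

Section Degree.
Variable n : nat.
Local Notation B := (power_basis P n).

Lemma power_gen_span (C : conj_class (wreath gT n)) : C \in B ->
  ([ffun D => (D == C)%:R] : burnside (wreath gT n)) \in burnside_span B.
Proof.
move=> CB; apply/forallP => D; apply/implyP => DB; rewrite ffunE.
by have [DC|//] := eqVneq D C; rewrite DC CB in DB.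
Qed.

Definition power_gen (i : 'I_#|B|) : power_span P n := PowerSpan (power_gen_span (enum_valP i)).

Lemma power_span_decomp (x : power_span P n) :
  x = \sum_i power_gen i *~ power_span_val x (enum_val i).
Proof.
pose v (y : power_span P n) : burnside (wreath gT n) := power_span_val y.
have vB : zmod_morphism v by [].
pose va := HB.pack_for {additive power_span P n -> burnside (wreath gT n)} v
  (GRing.isZmodMorphism.Build _ _ v vB).
apply/val_inj; rewrite -[RHS]/(va _) raddf_sum; apply/ffunP => C; rewrite sum_ffunE.
have E i : (va (power_gen i *~ power_span_val x (enum_val i))) C
    = if C == enum_val i then power_span_val x C else 0.
  rewrite raddfMz ffunMzE /= ffunE; case: eqP => [->|_]; last by rewrite mul0rz.
  exact: intz.
under eq_bigr => i _ do rewrite E.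
have [CB|CB] := boolP (C \in B).
  rewrite -big_mkcond (big_pred1 (enum_rank_in CB C)) // => i.
  apply/eqP/eqP => [Ci|->]; last by rewrite enum_rankK_in.
  by apply: enum_val_inj; rewrite enum_rankK_in.
rewrite big1 => [|i _]; first exact/eqP/(implyP (forallP (power_spanP x) C)).
by case: eqP => // Ci; move: CB; rewrite Ci enum_valP.
Qed.

Lemma power_basis_card (s : seq (parts_deg gT n)) :
  (forall l, l \in s) -> (#|B| <= size s)%N.
Proof.
move=> sP; have [f f_inj] := power_types_parts gT n.
rewrite cardE -(size_map f); apply: uniq_leq_size => [|l _]; last exact: sP.
rewrite map_inj_in_uniq ?enum_uniq // => C D; rewrite !mem_enum power_basisE.
exact: f_inj.
Qed.

(** The matrix of [chi] in degree [n] has at most as many rows as columns.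
    Delta functions being torsion modulo the image, its rows span all row
    vectors; hence it is square and invertible. *)
Lemma parks_hom_deg_inj : injective (@parks_hom_deg gT P chi n).
Proof.
apply: raddf_inj => x x0.
have [s0 s0P] := parts_deg_finite gT n; pose s := undup s0.
have sP l : l \in s by rewrite mem_undup.
pose M : 'M[rat]_(#|B|, size s) := \matrix_(i, j)
  (parks_hom_deg chi (power_gen i) (tnth (in_tuple s) j))%:~R.
pose vec (y : power_span P n) : 'rV[rat]_#|B| :=
  \row_i (power_span_val y (enum_val i))%:~R.
have vecM y : vec y *m M = \row_j (parks_hom_deg chi y (tnth (in_tuple s) j))%:~R.
  apply/rowP => j; rewrite !mxE {2}(power_span_decomp y) raddf_sum.
  set l := tnth _ j.
  have -> : (\sum_i parks_hom_deg chi (power_gen i *~ power_span_val y (enum_val i))) l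
    = \sum_i parks_hom_deg chi (power_gen i) l *~ power_span_val y (enum_val i).
    rewrite (big_morph (fun f : parks_deg gT int n => f l) (id1 := 0) (op1 := +%R)) //.
    apply: eq_bigr => i _; by rewrite raddfMz parks_degMz.
  rewrite rmorph_sum; apply: eq_bigr => i _.
  by rewrite !mxE /= rmorphMz /= -[RHS]mulrzr mulrC.
have Mfull : row_full M.
  rewrite -sub1mx; apply/row_subP => j; rewrite rowE mulmx1.
  have [d d0 [y yE]] := parks_torsion_image chiP
    (parks_delta (val (tnth (in_tuple s) j))).
  have := vecM (y n); set w := \row_k _ => wE.
  have -> : delta_mx 0 j = d%:~R^-1 *: w.
    apply/rowP => k; rewrite !mxE eqxx /= -parks_hom_component yE.
    have -> : (parks_delta (val (tnth (in_tuple s) j)) *~ d) n (tnth (in_tuple s) k)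
        = (k == j)%:R *~ d.
      rewrite -parks_evalE -[LHS]/(parks_at _ _) raddfMz; congr (_ *~ _).
      have /tuple_uniqP s_inj : uniq (in_tuple s) by apply: undup_uniq.
      by rewrite [LHS]parks_at_delta val_eqE (inj_eq s_inj).
    rewrite rmorphMz /= mulrzAr -[RHS]mulrzr mulrAC mulVf ?mul1r ?intr_eq0 //.
    by rewrite eq_sym; case: (j == k).
  by rewrite -wE scalemxAl submxMl.
have Mfree : row_free M.
  rewrite -row_leq_rank (eqP Mfull) power_basis_card //.
have vx : vec x = 0.
  apply: (row_free_inj Mfree); rewrite vecM mul0mx x0.
  by apply/rowP => j; rewrite !mxE.
apply/val_inj/ffunP => C; rewrite [RHS]ffunE.
have [CB|CB] := boolP (C \in B); last exact/eqP/(implyP (forallP (power_spanP x) C)).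
have /rowP/(_ (enum_rank_in CB C)) := vx; rewrite !mxE enum_rankK_in //.
by move/eqP; rewrite intr_eq0 => /eqP.
Qed.
End Degree.

End ParksHomComponents.

(** * Rationalisation of the parks homomorphism *)

Section Rational.
Variables (gT : finGroupType) (P : total_power gT).
Variables (chi : {additive power_ring P -> parks gT int}) (chiP : is_parks_hom chi).

Lemma parks_hom_inj : injective chi.
Proof.
apply: raddf_inj => x x0; apply: dsum_eq => n; apply: (parks_hom_deg_inj chiP).
by rewrite -(parks_hom_component chiP) x0 raddf0.
Qed.

Lemma scale_torsion (q : rat) (d a : int) : d != 0 ->
  (q / d%:~R) * (a *~ d)%:~R = q * a%:~R.
Proof.
move=> d0; rewrite rmorphMz /= -[X in _ * X]mulrzr -mulrA; congr (q * _).
by rewrite [a%:~R * _]mulrC mulKf ?intr_eq0.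
Qed.

Lemma parks_hom_scale_surj (w : parks gT rat) :
  exists q x, w = parks_scale q (chi x).
Proof.
have [q [f ->]] := parks_scale_surj w.
have [d d0 [x xf]] := parks_torsion_image chiP f.
exists (q / d%:~R), x; apply: dsum_eq => n; apply/funext => l.
rewrite xf -[LHS]/(q * (f n l)%:~R) -(scale_torsion q (f n l) d0).
rewrite -[RHS]/(q / d%:~R * ((f *~ d) n l)%:~R); congr (_ * _%:~R).
by rewrite -!parks_evalE -[RHS]/(parks_at _ _) raddfMz.
Qed.

Lemma parks_hom_deg_scale_surj n (w : parks_deg gT rat n) :
  exists q x, w = parks_scale_deg q (parks_hom_deg chi (x : power_span P n)).
Proof.
have [q [f ->]] := parks_scale_deg_surj w; pose F : parks gT int := dsum_in f.
have [d d0 [x xf]] := parks_torsion_image chiP F.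
exists (q / d%:~R), (x n); apply/funext => l.
rewrite -[LHS]/(q * (f l)%:~R) -(scale_torsion q (f l) d0).
rewrite -[RHS]/(q / d%:~R * (parks_hom_deg chi (x n) l)%:~R); congr (_ * _%:~R).
rewrite -(parks_hom_component chiP) xf -[in RHS]parks_evalE -[RHS]/(parks_at _ _) raddfMz.
by congr (_ *~ _); rewrite -[RHS]/(parks_eval _ _) parks_evalE /F dsum_in_id.
Qed.

End Rational.

Theorem corollary13p5 (gT : finGroupType) (P : total_power gT)
    (chi : {additive power_ring P -> parks gT int}) (chiP : is_parks_hom chi) :
  [/\ bijective (tensor_map (@idfun rat) chi :
        tensor rat (power_ring P) -> tensor rat (parks gT int)),
      bijective (@parks_rat gT),
      bijective (@parks_rat gT \o tensor_map (@idfun rat) chi)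
    & forall n, bijective (@parks_rat_deg gT n
                  \o tensor_map (@idfun rat) (@parks_hom_deg gT P chi n))].
Proof.
have total : bijective (@parks_rat gT \o tensor_map (@idfun rat) chi).
  apply: tensor_map_rat_bij; first exact: parks_scale_biadditive.
  - exact: parks_scale_eq0.
  - exact: parks_hom_inj.
  - exact: parks_hom_scale_surj.
split=> // [||n]; last 1 first.
- apply: tensor_map_rat_bij; first exact: parks_scale_deg_biadditive.
  + exact: parks_scale_deg_eq0.
  + exact: parks_hom_deg_inj.
  + exact: parks_hom_deg_scale_surj.
- have [g gK Kg] := parks_rat_bij gT.
  apply: (eq_bij (bij_comp (Bijective Kg gK) total)) => t; exact: gK.
- exact: parks_rat_bij.
Qed.
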